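(* Let a real number $w>0$ and an integer $\ell\geqslant 1$ be fixed. Then, as $k\to+\infty$, $$a_{k}(w)\to\mathfrak{a}(w),\qquad b_{k,\ell}(w)\to\mathfrak{b}_{\ell}(w),\qquad c_{k}(w)\to\mathfrak{c}(w),$$ where $$\mathfrak{a}(w)=\begin{cases}2,& w\in\mathbb{Z},\\ \dfrac{2[w]+1}{w},& w\notin\mathbb{Z},\end{cases}\qquad \mathfrak{c}(w)=\begin{cases}\dfrac{w+1/2}{w},& w\in\mathbb{Z},\\ \dfrac{[w]+1}{w},& w\notin\mathbb{Z},\end{cases}$$ $$\mathfrak{b}_{\ell}(w)=\frac{2}{w^{\ell+1}}\biggl(\frac{B_{\ell+1}([w])-B_{\ell+1}}{\ell+1}+\kappa[w]^{\ell}\biggr),\qquad \kappa=\begin{cases}1/2,& w\in\mathbb{Z},\\ 1,& w\notin\mathbb{Z}.\end{cases}$$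
   Context: $[w]$ is the integer part of $w$; $B_{j}(x)$ is the $j$-th Bernoulli polynomial and $B_{j}=B_{j}(0)$ the $j$-th Bernoulli number ($B_{0}=1$, $B_{1}=-\frac12$, $B_{2}=\frac16$, $\ldots$). $\psi(z)=\Gamma'(z)/\Gamma(z)$ is the digamma function. For integers $k\geqslant 1$ and $r\geqslant 0$ put $\varepsilon_{r}=\exp\bigl(\frac{2\pi i(r+1/2)}{2k}\bigr)$ and $\omega_{r}=\exp\bigl(\frac{2\pi i(r+1/2)}{2k+1}\bigr)$. For real $w>0$ define $$a_{k}(w)=\frac{1}{k}\sum_{r=0}^{k-1}\pi\varepsilon_{r}\cot(\pi\varepsilon_{r}w),\quad b_{k,\ell}(w)=\frac{(-1)^{\ell+1}}{k}\sum_{r=0}^{2k-1}\varepsilon_{r}^{\ell+1}\psi(\varepsilon_{r}w),\quad c_{k}(w)=\frac{1}{2k+1}\sum_{r=0}^{2k}\omega_{r}\psi(-\omega_{r}w).$$ *)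

(* Defs.v *)
(* Stdlib reals with Coquelicot's complex numbers. *)
From Stdlib Require Import Arith Reals Lra Lia.
From Coquelicot Require Import Coquelicot.

Open Scope R_scope.

Definition Cexp (z : C) : C :=
  (exp (Re z) * cos (Im z), exp (Re z) * sin (Im z)).

Definition Ccos (z : C) : C := ((Cexp (Ci * z) + Cexp (- (Ci * z))) / 2)%C.
Definition Csin (z : C) : C := ((Cexp (Ci * z) - Cexp (- (Ci * z))) / (2 * Ci))%C.
Definition Ccot (z : C) : C := (Ccos z / Csin z)%C.

(* [rising z n] is [z (z + 1) ... (z + n)], with [n + 1] factors. *)
Fixpoint rising (z : C) (n : nat) : C :=
  match n with
  | O => z
  | S m => (rising z m * (z + INR (S m)))%C
  end.

(* Gauss's product [Gamma z = lim_n n! n^z / (z (z + 1) ... (z + n))], valid on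
   the whole plane outside the poles 0, -1, -2, ... of Gamma. The limit is taken
   separately on real and imaginary parts; the values at the poles are junk. *)
Definition CGamma_seq (z : C) (n : nat) : C :=
  (INR (fact n) * Cexp (z * ln (INR n)) / rising z n)%C.

Definition CGamma (z : C) : C :=
  (real (Lim_seq (fun n => Re (CGamma_seq z n))),
   real (Lim_seq (fun n => Im (CGamma_seq z n)))).

Definition Cdigamma (z : C) : C := (C_derive CGamma z / CGamma z)%C.

(* [bernoulli_upto n j] is the Bernoulli number [B_j] for [j <= n], computed from
   [B_0 = 1] and [sum_(j <= m) binom(m + 1, j) B_j = 0] for [m >= 1].
   [C] alone denotes the complex numbers, hence the qualified [Binomial.C]. *)
Fixpoint bernoulli_upto (n : nat) : nat -> R :=
  match n with
  | O => fun _ => 1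
  | S m => fun j =>
      if Nat.eqb j (S m)
      then - sum_f_R0 (fun i => Binomial.C (m + 2) i * bernoulli_upto m i) m
             / INR (m + 2)
      else bernoulli_upto m j
  end.

Definition bernoulli (n : nat) : R := bernoulli_upto n n.

Definition bernoulli_poly (n : nat) (x : R) : R :=
  sum_f_R0 (fun j => Binomial.C n j * bernoulli j * x ^ (n - j)) n.

Lemma bernoulli_upto_le (n j : nat) :
  (j <= n)%nat -> bernoulli_upto n j = bernoulli j.
Proof.
induction n as [|n IH]; intros Hj.
- now replace j with O by lia.
- destruct (Nat.eq_dec j (S n)) as [->|Hne]; [reflexivity|].
  simpl. rewrite (proj2 (Nat.eqb_neq j (S n)) Hne). apply IH; lia.
Qed.

Lemma bernoulli_rec (m : nat) : (1 <= m)%nat ->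
  sum_f_R0 (fun j => Binomial.C (m + 1) j * bernoulli j) m = 0.
Proof.
destruct m as [|m]; intros Hm; [lia|].
assert (Hb : bernoulli (S m) =
  - sum_f_R0 (fun j => Binomial.C (S m + 1) j * bernoulli j) m / INR (m + 2)).
{ unfold bernoulli at 1; simpl bernoulli_upto. rewrite Nat.eqb_refl.
  replace (S m + 1)%nat with (m + 2)%nat by lia.
  do 2 f_equal. apply sum_eq; intros i Hi. now rewrite bernoulli_upto_le. }
rewrite tech5, Hb.
replace (Binomial.C (S m + 1) (S m)) with (INR (m + 2)).
- field. apply not_0_INR; lia.
- replace (S m + 1)%nat with (S (S m)) by lia.
  rewrite pascal_step2, C_n_n by lia.
  replace (S (S m) - S m)%nat with 1%nat by lia.
  replace (m + 2)%nat with (S (S m)) by lia. rewrite INR_1. field.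
Qed.

Lemma bernoulli_poly_0 (n : nat) : bernoulli_poly n 0 = bernoulli n.
Proof.
unfold bernoulli_poly. destruct n as [|n].
- simpl. rewrite C_n_n. ring.
- rewrite tech5, Nat.sub_diag, C_n_n.
  rewrite (sum_eq _ (fun _ => 0)), sum_cte; [simpl; ring|].
  intros i Hi. rewrite pow_ne_zero by lia. ring.
Qed.

Definition is_integer (w : R) : Prop := exists n : Z, w = IZR n.

Lemma is_integer_dec (w : R) : {is_integer w} + {~ is_integer w}.
Proof.
destruct (Req_dec_T w (IZR (Int_part w))) as [H|H].
- left. now exists (Int_part w).
- right. intros [n Hn]. apply H.
  assert (E : n = Int_part w) by (apply Int_part_spec; lra).
  now rewrite <- E.
Qed.

(* [eps k r] and [omega k r] are the 2k-th, resp. (2k+1)-th, roots of -1. *)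
Definition eps (k r : nat) : C :=
  Cexp (2 * PI * Ci * (INR r + / 2) / (2 * INR k))%C.

Definition omega (k r : nat) : C :=
  Cexp (2 * PI * Ci * (INR r + / 2) / (2 * INR k + 1))%C.

Definition a_ (k : nat) (w : R) : C :=
  (/ INR k * sum_n (fun r => PI * eps k r * Ccot (PI * eps k r * w)) (k - 1))%C.

Definition b_ (k l : nat) (w : R) : C :=
  ((-1) ^ (l + 1) / INR k *
   sum_n (fun r => eps k r ^ (l + 1) * Cdigamma (eps k r * w)) (2 * k - 1))%C.

Definition c_ (k : nat) (w : R) : C :=
  (/ (2 * INR k + 1) *
   sum_n (fun r => omega k r * Cdigamma (- omega k r * w)) (2 * k))%C.

Definition a_lim (w : R) : R :=
  if is_integer_dec w then 2 else (2 * IZR (Int_part w) + 1) / w.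

Definition kappa (w : R) : R := if is_integer_dec w then / 2 else 1.

Definition b_lim (l : nat) (w : R) : R :=
  2 / w ^ (l + 1) *
  ((bernoulli_poly (l + 1) (IZR (Int_part w)) - bernoulli (l + 1)) / INR (l + 1)
   + kappa w * IZR (Int_part w) ^ l).

Definition c_lim (w : R) : R :=
  if is_integer_dec w then (w + / 2) / w else (IZR (Int_part w) + 1) / w.

(* Main.v *)
Require Import Defs.
From Stdlib Require Import Reals Lra Lia ZArith.
From Coquelicot Require Import Coquelicot.

(** The cotangent and the digamma function are limits of partial fractions with
    poles at integers:
      [pi cot (pi z) + 1 / z = sum_(n >= 0) (1 / (z + n) + 1 / (z - n))],
      [psi z = lim_n (ln n - sum_(j <= n) 1 / (z + j))].
    Averaging [1 / (n - zeta w)], weighted by a power [zeta ^ m], over the roots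
    of [zeta ^ N = -1] is a finite computation
    ([root_system_partial_fraction]): expanding in a geometric progression, only
    the power [zeta ^ N] survives the average, which leaves
      [- w ^ (N - m) n ^ (m - 1) / (n ^ N + w ^ N)],
    and the terms [ln n] are averaged away. (For the cotangent, the poles [n] and
    [- n] are paired first, and the computation is made with [n ^ 2], [w ^ 2] and
    the roots of [zeta ^ k = -1].) Each of the three
    sequences is therefore an explicit real series. With
    [Q_N n = w ^ N / (n ^ N + w ^ N)],
      [a_k = - 1 / w + 2 / w * sum_n Q_(2k) n],
      [b_k = 2 / w ^ (l + 1) * sum_n n ^ l Q_(2k) n],
      [c_k = 1 / w * sum_n Q_(2k+1) n].
    As [N] grows, [Q_N n] tends to 1, 1/2 or 0 according to whether [n] is below,
    equal to or above [w]. Since [n ^ p Q_N n <= w ^ (p + 2) / n ^ 2] for [n >= w]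
    and [N >= p + 2], dominated convergence applies ([cutoff_power_sum]) and the
    limits are the sums of [n ^ p] over the integers [n <= w], the last one being
    halved when [w] is an integer. Bernoulli polynomials evaluate these sums
    ([bernoulli_power_sum]).

    The two expansions are proved from the definitions. For the cotangent
    ([Ccot_partial_fractions]), the partial fraction of [1 / (1 - x ^ N)] over the
    roots of unity gives [N cot (N t)] as a sum of [N] translates of [cot t];
    dominated convergence handles [N -> oo]. For the digamma function
    ([Cdigamma_lim]), Gauss's product converges to a nonzero limit by comparison
    with the product of the factors [exp (z / j) / (1 + z / j) = 1 + O (1 / j ^ 2)];
    the same factors at [h / (z + j)] in place of [z / j] show that the [n]-th
    Gauss approximation [G_n] of Gamma satisfies
      [G_n (z + h) = G_n z * (1 + h L_n + O (h ^ 2))]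
    uniformly in [n], with [L_n = ln n - sum_(j <= n) 1 / (z + j)]. This bound passes to the
    limit and gives the derivative of Gamma without any theory of holomorphic
    functions. *)

(** * Limits of complex sequences *)

(** Reducing to a real limit makes the squeeze theorem for real sequences
    directly available for error estimates. *)
Definition is_lim_Cseq (u : nat -> C) (l : C) : Prop :=
  is_lim_seq (fun n => Cmod (u n - l)) 0.

Lemma is_lim_Cseq_le (u : nat -> C) (l : C) (v : nat -> R) :
  eventually (fun n => Cmod (u n - l) <= v n) -> is_lim_seq v 0 ->
  is_lim_Cseq u l.
Proof.
  intros Hle Hv. unfold is_lim_Cseq.
  apply is_lim_seq_le_le_loc with (fun _ => 0) v; trivial.
  - destruct Hle as [N HN]. exists N. intros n Hn.
    split; [apply Cmod_ge_0 | now apply HN].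
  - apply is_lim_seq_const.
Qed.

Lemma is_lim_Cseq_ext_loc (u v : nat -> C) (l : C) :
  eventually (fun n => u n = v n) -> is_lim_Cseq u l -> is_lim_Cseq v l.
Proof.
  intros [N HN] Hu. unfold is_lim_Cseq in *.
  apply is_lim_seq_ext_loc with (2 := Hu).
  exists N. intros n Hn. now rewrite HN.
Qed.

Lemma is_lim_Cseq_ext (u v : nat -> C) (l : C) :
  (forall n, u n = v n) -> is_lim_Cseq u l -> is_lim_Cseq v l.
Proof. intros H. apply is_lim_Cseq_ext_loc. now exists O. Qed.

Lemma is_lim_Cseq_const (l : C) : is_lim_Cseq (fun _ => l) l.
Proof.
  apply is_lim_seq_ext with (fun _ => 0); [|apply is_lim_seq_const].
  intros _. replace (l - l)%C with (RtoC 0) by ring. now rewrite Cmod_0.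
Qed.

Lemma is_lim_Cseq_plus (u v : nat -> C) (l m : C) :
  is_lim_Cseq u l -> is_lim_Cseq v m ->
  is_lim_Cseq (fun n => u n + v n)%C (l + m)%C.
Proof.
  intros Hu Hv.
  apply is_lim_Cseq_le with (fun n => Cmod (u n - l) + Cmod (v n - m)).
  - exists O. intros n _.
    replace (u n + v n - (l + m))%C with ((u n - l) + (v n - m))%C by ring.
    apply Cmod_triangle.
  - replace 0 with (0 + 0) by ring. now apply is_lim_seq_plus'.
Qed.

Lemma is_lim_Cseq_mult (u v : nat -> C) (l m : C) :
  is_lim_Cseq u l -> is_lim_Cseq v m ->
  is_lim_Cseq (fun n => u n * v n)%C (l * m)%C.
Proof.
  intros Hu Hv.
  apply is_lim_Cseq_le with
    (fun n => Cmod (u n - l) * (Cmod (v n - m) + Cmod m)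
              + Cmod l * Cmod (v n - m)).
  - exists O. intros n _.
    replace (u n * v n - l * m)%C
      with ((u n - l) * ((v n - m) + m) + l * (v n - m))%C by ring.
    eapply Rle_trans; [apply Cmod_triangle|]. rewrite !Cmod_mult.
    apply Rplus_le_compat_r, Rmult_le_compat_l;
      [apply Cmod_ge_0 | apply Cmod_triangle].
  - replace 0 with (0 * (0 + Cmod m) + Cmod l * 0) by ring.
    apply is_lim_seq_plus'; apply is_lim_seq_mult'; trivial;
      try apply is_lim_seq_plus'; trivial; apply is_lim_seq_const.
Qed.

Lemma is_lim_Cseq_scal (a : C) (u : nat -> C) (l : C) :
  is_lim_Cseq u l -> is_lim_Cseq (fun n => a * u n)%C (a * l)%C.
Proof. apply is_lim_Cseq_mult, is_lim_Cseq_const. Qed.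

Lemma is_lim_Cseq_minus (u v : nat -> C) (l m : C) :
  is_lim_Cseq u l -> is_lim_Cseq v m ->
  is_lim_Cseq (fun n => u n - v n)%C (l - m)%C.
Proof.
  intros Hu Hv. replace (l - m)%C with (l + -(1) * m)%C by ring.
  apply is_lim_Cseq_ext with (fun n => u n + -(1) * v n)%C;
    [intros n; ring|].
  now apply is_lim_Cseq_plus, is_lim_Cseq_scal.
Qed.

Lemma Cmod_minus_sym (x y : C) : Cmod (x - y) = Cmod (y - x).
Proof. rewrite <- Cmod_opp. f_equal. ring. Qed.

Lemma Cmod_triangle_inv (x y : C) : Cmod x - Cmod y <= Cmod (x - y).
Proof.
  assert (H := Cmod_triangle (x - y) y).
  replace (x - y + y)%C with x in H by ring. lra.
Qed.

Lemma is_lim_Cseq_Cmod (u : nat -> C) (l : C) :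
  is_lim_Cseq u l -> is_lim_seq (fun n => Cmod (u n)) (Cmod l).
Proof.
  intros Hu.
  apply is_lim_seq_le_le with (fun n => Cmod l - Cmod (u n - l))
    (fun n => Cmod l + Cmod (u n - l)).
  - intros n.
    assert (H1 := Cmod_triangle_inv l (u n)). rewrite Cmod_minus_sym in H1.
    assert (H2 := Cmod_triangle_inv (u n) l). lra.
  - replace (Cmod l) with (Cmod l - 0) at 1 by ring.
    apply is_lim_seq_minus'; trivial; apply is_lim_seq_const.
  - replace (Cmod l) with (Cmod l + 0) at 1 by ring.
    apply is_lim_seq_plus'; trivial; apply is_lim_seq_const.
Qed.

Lemma is_lim_Cseq_inv (u : nat -> C) (l : C) :
  l <> 0 -> is_lim_Cseq u l -> is_lim_Cseq (fun n => / u n)%C (/ l)%C.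
Proof.
  intros Hl Hu. assert (Hl' := proj1 (Cmod_gt_0 l) Hl).
  assert (HC := is_lim_Cseq_Cmod u l Hu).
  assert (Hne : eventually (fun n => 0 < Cmod (u n))).
  { assert (HC' := HC). apply is_lim_seq_spec in HC'.
    destruct (HC' (mkposreal _ Hl')) as [N HN]. exists N. intros n Hn.
    specialize (HN n Hn). simpl in HN. apply Rabs_def2 in HN. lra. }
  apply is_lim_Cseq_le with (fun n => Cmod (u n - l) * (/ Cmod (u n) * / Cmod l)).
  - destruct Hne as [N HN]. exists N. intros n Hn.
    assert (Hun : u n <> 0) by (apply Cmod_gt_0, HN, Hn).
    rewrite <- !Cmod_inv, <- !Cmod_mult by trivial.
    rewrite Cmod_minus_sym. right. f_equal. field. now split.
  - replace 0 with (0 * (/ Cmod l * / Cmod l)) by ring.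
    apply is_lim_seq_mult'; trivial.
    apply is_lim_seq_mult'; [|apply is_lim_seq_const].
    apply (is_lim_seq_inv _ _ HC). intros H; injection H; clear - Hl'; intros H; lra.
Qed.

Lemma is_lim_Cseq_unique (u : nat -> C) (l m : C) :
  is_lim_Cseq u l -> is_lim_Cseq u m -> l = m.
Proof.
  intros Hl Hm. assert (H := is_lim_Cseq_minus _ _ _ _ Hl Hm).
  apply is_lim_Cseq_Cmod in H.
  assert (H0 : is_lim_seq (fun n => Cmod (u n - u n)) 0)
    by (apply is_lim_seq_ext with (fun _ => 0); [|apply is_lim_seq_const];
        intros n; replace (u n - u n)%C with (RtoC 0) by ring;
        now rewrite Cmod_0).
  apply is_lim_seq_unique in H, H0. rewrite H in H0. injection H0 as H0.
  apply Cmod_eq_0 in H0. replace l with ((l - m) + m)%C by ring.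
  rewrite H0. ring.
Qed.

Lemma im_le_Cmod (z : C) : Rabs (Im z) <= Cmod z.
Proof.
  eapply Rle_trans; [|apply Rmax_Cmod]. apply Rmax_r.
Qed.

Lemma is_lim_Cseq_Re (u : nat -> C) (l : C) :
  is_lim_Cseq u l -> is_lim_seq (fun n => Re (u n)) (Re l).
Proof.
  intros Hu. apply is_lim_seq_le_le with
    (fun n => Re l - Cmod (u n - l)) (fun n => Re l + Cmod (u n - l)).
  - intros n. assert (H := re_le_Cmod (u n - l)).
    replace (Re (u n - l)) with (Re (u n) - Re l) in H by reflexivity.
    apply Rabs_le_between in H. lra.
  - replace (Re l) with (Re l - 0) at 1 by ring.
    apply is_lim_seq_minus'; trivial; apply is_lim_seq_const.
  - replace (Re l) with (Re l + 0) at 1 by ring.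
    apply is_lim_seq_plus'; trivial; apply is_lim_seq_const.
Qed.

Lemma is_lim_Cseq_Im (u : nat -> C) (l : C) :
  is_lim_Cseq u l -> is_lim_seq (fun n => Im (u n)) (Im l).
Proof.
  intros Hu. apply is_lim_seq_le_le with
    (fun n => Im l - Cmod (u n - l)) (fun n => Im l + Cmod (u n - l)).
  - intros n. assert (H := im_le_Cmod (u n - l)).
    replace (Im (u n - l)) with (Im (u n) - Im l) in H by reflexivity.
    apply Rabs_le_between in H. lra.
  - replace (Im l) with (Im l - 0) at 1 by ring.
    apply is_lim_seq_minus'; trivial; apply is_lim_seq_const.
  - replace (Im l) with (Im l + 0) at 1 by ring.
    apply is_lim_seq_plus'; trivial; apply is_lim_seq_const.
Qed.

Lemma is_lim_Cseq_RtoC (u : nat -> R) (l : R) :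
  is_lim_seq u l -> is_lim_Cseq (fun n => RtoC (u n)) (RtoC l).
Proof.
  intros Hu. unfold is_lim_Cseq.
  apply is_lim_seq_ext with (fun n => Rabs (u n - l)).
  - intros n. now rewrite <- RtoC_minus, Cmod_R.
  - replace 0 with (Rabs (l - l)) by (rewrite Rminus_diag; apply Rabs_R0).
    apply (is_lim_seq_abs _ (l - l)), is_lim_seq_minus'; trivial.
    apply is_lim_seq_const.
Qed.

Lemma is_lim_Cseq_filterlim (u : nat -> C) (l : C) :
  is_lim_Cseq u l -> filterlim u eventually (locally l).
Proof.
  intros Hu P [eps HP].
  assert (H : eventually (fun n => Cmod (u n - l) < eps)).
  { apply is_lim_seq_spec in Hu.
    destruct (Hu eps) as [N HN]. exists N. intros n Hn.
    specialize (HN n Hn). rewrite Rminus_0_r in HN.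
    apply Rabs_def2 in HN. lra. }
  destruct H as [N HN]. exists N. intros n Hn.
  apply HP, C_NormedModule_mixin_compat1, HN, Hn.
Qed.

(** * Finite sums and the Cauchy criterion *)

(** The next lemmas restate generic facts on [sum_n] with the equality at type
    [R] or [C], where [ring] and [field] recognise it. *)
Lemma sum_Sn_R (a : nat -> R) (n : nat) :
  (sum_n a (S n) : R) = sum_n a n + a (S n).
Proof. exact (sum_Sn a n). Qed.

Lemma sum_Sn_C (a : nat -> C) (n : nat) :
  (sum_n a (S n) : C) = (sum_n a n + a (S n))%C.
Proof. exact (sum_Sn a n). Qed.

Lemma sum_n_mult_l_C (c : C) (a : nat -> C) (n : nat) :
  (sum_n (fun i => c * a i)%C n : C) = (c * sum_n a n)%C.
Proof. exact (sum_n_mult_l (K := C_Ring) c a n). Qed.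

Lemma sum_n_mult_l_R (c : R) (a : nat -> R) (n : nat) :
  (sum_n (fun i => c * a i) n : R) = c * sum_n a n.
Proof. exact (sum_n_mult_l (K := R_Ring) c a n). Qed.

Lemma sum_n_ext_C (a b : nat -> C) (n : nat) :
  (forall i, (i <= n)%nat -> a i = b i) -> (sum_n a n : C) = sum_n b n.
Proof. exact (sum_n_ext_loc a b n). Qed.

Lemma Cmod_sum_n (a : nat -> C) (n : nat) :
  Cmod (sum_n a n) <= sum_n (fun i => Cmod (a i)) n.
Proof.
  induction n as [|n IH].
  - rewrite !sum_O. lra.
  - rewrite sum_Sn_R, sum_Sn_C. eapply Rle_trans; [apply Cmod_triangle|]. lra.
Qed.

Lemma is_lim_Cseq_sum_n (f : nat -> nat -> C) (g : nat -> C) (n : nat) :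
  (forall i, (i <= n)%nat -> is_lim_Cseq (fun k => f k i) (g i)) ->
  is_lim_Cseq (fun k => sum_n (f k) n) (sum_n g n).
Proof.
  induction n as [|n IH]; intros H.
  - rewrite sum_O. apply is_lim_Cseq_ext with (fun k => f k O); [|now apply H].
    intros k. now rewrite sum_O.
  - rewrite sum_Sn_C.
    apply is_lim_Cseq_ext with (fun k => sum_n (f k) n + f k (S n))%C;
      [intros k; now rewrite sum_Sn_C|].
    apply is_lim_Cseq_plus; [apply IH|]; intros; apply H; lia.
Qed.

(** A Cauchy criterion with an explicit modulus [e]. *)
Lemma Cauchy_is_lim_Cseq (u : nat -> C) (e : nat -> R) :
  is_lim_seq e 0 ->
  eventually (fun n => forall m, (n <= m)%nat -> Cmod (u m - u n) <= e n) ->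
  exists l, is_lim_Cseq u l.
Proof.
  intros He [N0 HN0].
  assert (Hc : forall f : C -> R, (forall x y, f (x - y)%C = f x - f y) ->
            (forall x, Rabs (f x) <= Cmod x) ->
            exists l : R, is_lim_seq (fun n => f (u n)) l).
  { intros f Hf Hle. apply ex_lim_seq_cauchy_corr. intros eps.
    apply is_lim_seq_spec in He.
    destruct (He (pos_div_2 eps)) as [N1 HN1]. exists (max N0 N1).
    assert (Haux : forall m, (max N0 N1 <= m)%nat ->
              Rabs (f (u m) - f (u (max N0 N1))) < eps / 2).
    { intros m Hm. rewrite <- Hf. eapply Rle_lt_trans; [apply Hle|].
      eapply Rle_lt_trans; [apply HN0; lia|].
      specialize (HN1 (max N0 N1) ltac:(lia)). simpl in HN1.
      rewrite Rminus_0_r in HN1. apply Rabs_def2 in HN1. lra. }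
    intros n m Hn Hm. assert (H1 := Haux n Hn). assert (H2 := Haux m Hm).
    apply Rabs_def2 in H1, H2. apply Rabs_def1; lra. }
  destruct (Hc Re) as [x Hx];
    [intros; reflexivity | apply re_le_Cmod|].
  destruct (Hc Im) as [y Hy];
    [intros; reflexivity | apply im_le_Cmod|].
  exists (x, y).
  apply is_lim_Cseq_le with (fun n => Rabs (Re (u n) - x) + Rabs (Im (u n) - y)).
  - exists O. intros n _.
    replace (u n - (x, y))%C
      with (RtoC (Re (u n) - x) + Ci * RtoC (Im (u n) - y))%C
      by (apply injective_projections; simpl; unfold Re, Im; ring).
    eapply Rle_trans; [apply Cmod_triangle|].
    rewrite Cmod_mult, Cmod_Ci, !Cmod_R. lra.
  - replace 0 with (Rabs (x - x) + Rabs (y - y))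
      by (rewrite !Rminus_diag, Rabs_R0; ring).
    apply is_lim_seq_plus';
      [apply (is_lim_seq_abs _ (x - x)) | apply (is_lim_seq_abs _ (y - y))];
      apply is_lim_seq_minus'; trivial; apply is_lim_seq_const.
Qed.

(** * Dominated convergence of series *)
Lemma dominated_tail (a : nat -> C) (M : nat -> R) (n0 n m : nat) :
  (forall i, (n0 <= i)%nat -> Cmod (a i) <= M i) ->
  (n0 <= n <= m)%nat ->
  Cmod (sum_n a m - sum_n a n) <= sum_n M m - sum_n M n.
Proof.
  intros Ha [Hn Hm]. induction Hm as [|m Hm IH].
  - rewrite !Rminus_diag. replace (sum_n a n - sum_n a n)%C with (RtoC 0) by ring.
    rewrite Cmod_0. lra.
  - rewrite !sum_Sn_R, !sum_Sn_C.
    replace (sum_n a m + a (S m) - sum_n a n)%C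
      with ((sum_n a m - sum_n a n) + a (S m))%C by ring.
    eapply Rle_trans; [apply Cmod_triangle|].
    specialize (Ha (S m) ltac:(lia)). lra.
Qed.

Lemma dominated_tail_lim (a : nat -> C) (M : nat -> R) (n0 n : nat) (s : C) :
  (forall i, (n0 <= i)%nat -> Cmod (a i) <= M i) -> ex_series M ->
  (n0 <= n)%nat -> is_lim_Cseq (sum_n a) s ->
  Cmod (s - sum_n a n) <= Series M - sum_n M n.
Proof.
  intros Ha HM Hn Hs.
  assert (H1 := is_lim_Cseq_Cmod _ _
    (is_lim_Cseq_minus _ _ _ _ Hs (is_lim_Cseq_const (sum_n a n)))).
  assert (H2 : is_lim_seq (fun m => sum_n M m - sum_n M n)
                          (Series M - sum_n M n)).
  { apply is_lim_seq_minus'; [apply (Series_correct M HM)|].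
    apply is_lim_seq_const. }
  refine (is_lim_seq_le_loc _ _ (Cmod (s - sum_n a n)) (Series M - sum_n M n)
            _ H1 H2).
  exists n. intros m Hm. apply dominated_tail with n0; [exact Ha|lia].
Qed.

Lemma is_lim_seq_tail (M : nat -> R) :
  ex_series M -> is_lim_seq (fun n => Series M - sum_n M n) 0.
Proof.
  intros HM. rewrite <- (Rminus_diag (Series M)).
  apply is_lim_seq_minus'; [apply is_lim_seq_const|].
  apply (Series_correct M HM).
Qed.

Lemma dominated_ex_lim (a : nat -> C) (M : nat -> R) (n0 : nat) :
  (forall i, (n0 <= i)%nat -> Cmod (a i) <= M i) -> ex_series M ->
  exists s, is_lim_Cseq (sum_n a) s.
Proof.
  intros Ha HM.
  apply Cauchy_is_lim_Cseq with (1 := is_lim_seq_tail M HM).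
  exists n0. intros n Hn m Hm.
  eapply Rle_trans; [apply (dominated_tail a M n0); auto|].
  apply Rplus_le_compat_r.
  refine (is_lim_seq_le_loc (fun _ => sum_n M m) (sum_n M) (sum_n M m) (Series M)
            _ (is_lim_seq_const _) (Series_correct M HM)).
  exists m. intros p Hp.
  assert (H := dominated_tail a M n0 m p Ha ltac:(lia)).
  assert (H' := Cmod_ge_0 (sum_n a p - sum_n a m)). lra.
Qed.

(** Tannery's theorem: after index [n] every series differs from its partial sum
    by at most the tail of [sum M], uniformly in [k], so limits may be taken term
    by term. Domination is only asked for large [k] and [n], because the bounds
    available below fail for the first few terms. *)
Theorem dominated_convergence_sum (f : nat -> nat -> C) (g S : nat -> C)
    (M : nat -> R) (n0 k0 : nat) :
  (forall k n, (k0 <= k)%nat -> (n0 <= n)%nat -> Cmod (f k n) <= M n) ->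
  ex_series M ->
  (forall n, is_lim_Cseq (fun k => f k n) (g n)) ->
  (forall k, (k0 <= k)%nat -> is_lim_Cseq (sum_n (f k)) (S k)) ->
  exists s, is_lim_Cseq (sum_n g) s /\ is_lim_Cseq S s.
Proof.
  intros Hf HM Hg HS.
  assert (HgM : forall n, (n0 <= n)%nat -> Cmod (g n) <= M n).
  { intros n Hn.
    refine (is_lim_seq_le_loc _ (fun _ => M n) (Cmod (g n)) (M n) _
              (is_lim_Cseq_Cmod _ _ (Hg n)) (is_lim_seq_const _)).
    exists k0. intros k Hk. now apply Hf. }
  destruct (dominated_ex_lim g M n0 HgM HM) as [s Hs]. exists s. split; trivial.
  apply is_lim_seq_spec. intros eps. simpl.
  assert (Heps := cond_pos eps).
  assert (Ht := is_lim_seq_tail M HM). apply is_lim_seq_spec in Ht.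
  destruct (Ht (mkposreal (eps / 3) ltac:(lra))) as [n1 Hn1]. simpl in Hn1.
  set (n := max n0 n1). specialize (Hn1 n ltac:(lia)).
  rewrite Rminus_0_r in Hn1. apply Rabs_def2 in Hn1.
  assert (Hh : is_lim_Cseq (fun k => sum_n (f k) n) (sum_n g n))
    by (apply is_lim_Cseq_sum_n; auto).
  apply is_lim_seq_spec in Hh.
  destruct (Hh (mkposreal (eps / 3) ltac:(lra))) as [k1 Hk1]. simpl in Hk1.
  exists (max k0 k1). intros k Hk. specialize (Hk1 k ltac:(lia)).
  rewrite Rminus_0_r in *. apply Rabs_def2 in Hk1.
  rewrite Rabs_pos_eq by apply Cmod_ge_0.
  assert (H1 := dominated_tail_lim (f k) M n0 n (S k)
    (fun i => Hf k i ltac:(lia)) HM ltac:(lia) (HS k ltac:(lia))).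
  assert (H2 := dominated_tail_lim g M n0 n s HgM HM ltac:(lia) Hs).
  replace (S k - s)%C with
    ((S k - sum_n (f k) n) + ((sum_n (f k) n - sum_n g n) + (sum_n g n - s)))%C
    by ring.
  rewrite Cmod_minus_sym in H2.
  assert (T1 := Cmod_triangle (S k - sum_n (f k) n)
                 ((sum_n (f k) n - sum_n g n) + (sum_n g n - s))).
  assert (T2 := Cmod_triangle (sum_n (f k) n - sum_n g n) (sum_n g n - s)).
  lra.
Qed.

(** Comparison with twice the telescoping series of [1 / (n + 1) - 1 / (n + 2)]. *)
Lemma ex_series_inv_sqr : ex_series (fun n => / INR (S n) ^ 2).
Proof.
  apply (ex_series_le (K := R_AbsRing) (V := R_CompleteNormedModule) _
           (fun n => 2 * (/ INR (S n) - / INR (S (S n))))).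
  - intros n. unfold norm; simpl norm; unfold abs; simpl abs.
    assert (H := pos_INR n).
    rewrite Rabs_pos_eq.
    2:{ left. apply Rinv_0_lt_compat, pow_lt. rewrite S_INR. lra. }
    rewrite !S_INR.
    replace (2 * (/ (INR n + 1) - / (INR n + 1 + 1)))
      with (2 / ((INR n + 1) * (INR n + 1 + 1))) by (field; lra).
    replace (/ (INR n + 1) ^ 2) with (2 / ((INR n + 1) * (2 * (INR n + 1))))
      by (field; lra).
    unfold Rdiv. apply Rmult_le_compat_l; [lra|].
    apply Rinv_le_contravar; nra.
  - exists (2 * (1 - 0)).
    assert (E : forall N, 2 * (1 - / INR (S (S N)))
              = sum_n (fun n => 2 * (/ INR (S n) - / INR (S (S n)))) N).
    { induction N as [|N IH].
      - rewrite sum_O, INR_1, Rinv_1. reflexivity.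
      - rewrite sum_Sn_R, <- IH. ring. }
    apply (is_lim_seq_ext (fun N => 2 * (1 - / INR (S (S N)))) _
             (2 * (1 - 0)));
      [exact E|].
    apply is_lim_seq_mult'; [apply is_lim_seq_const|].
    apply is_lim_seq_minus'; [apply is_lim_seq_const|].
    assert (H : is_lim_seq (fun n => / INR n) 0).
    { apply (is_lim_seq_inv _ p_infty is_lim_seq_INR). easy. }
    apply is_lim_seq_incr_n with (N := 2%nat) in H.
    apply is_lim_seq_ext with (2 := H). intros n. do 2 f_equal. lia.
Qed.

Lemma ex_series_scal_inv_sqr (c : R) : ex_series (fun n => c / INR n ^ 2).
Proof.
  apply ex_series_incr_1.
  apply (ex_series_scal_l c _ ex_series_inv_sqr).
Qed.

(** * A smoothed indicator of the integers below w *)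

(** The weight with which the [n]-th pole enters an average over the [N] roots
    of -1, up to a constant; for large [N] it approximates the indicator of [n < w]. *)
Definition cutoff (w : R) (N n : nat) : R := w ^ N / (INR n ^ N + w ^ N).

Definition cutoff_lim (w : R) (n : nat) : R :=
  if Rlt_dec (INR n) w then 1 else if Rlt_dec w (INR n) then 0 else / 2.

Lemma cutoff_inv (w : R) (N n : nat) : 0 < w ->
  cutoff w N n = / (1 + (INR n / w) ^ N).
Proof.
  intros Hw. unfold cutoff, Rdiv. rewrite Rpow_mult_distr, pow_inv.
  assert (0 < w ^ N) by now apply pow_lt.
  assert (0 <= INR n ^ N) by apply pow_le, pos_INR.
  field. lra.
Qed.

Lemma is_lim_cutoff (w : R) (n : nat) : 0 < w ->
  is_lim_seq (fun N => cutoff w N n) (cutoff_lim w n).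
Proof.
  intros Hw.
  assert (Hn := pos_INR n).
  assert (Hx : 0 <= INR n / w) by (apply Rdiv_le_0_compat; lra).
  unfold cutoff_lim. destruct (Rlt_dec (INR n) w) as [H1|H1].
  - apply is_lim_seq_ext with (fun N => / (1 + (INR n / w) ^ N));
      [intros; now rewrite cutoff_inv|].
    replace (Finite 1) with (Rbar_inv (1 + 0)) by (simpl; f_equal; field).
    apply is_lim_seq_inv.
    + apply is_lim_seq_plus'; [apply is_lim_seq_const|].
      apply is_lim_seq_geom. rewrite Rabs_pos_eq by trivial.
      apply Rlt_div_l; lra.
    + intros H; injection H; lra.
  - destruct (Rlt_dec w (INR n)) as [H2|H2].
    + apply is_lim_seq_le_le with (fun _ => 0) (fun N => (w / INR n) ^ N).
      * intros N. rewrite cutoff_inv by trivial.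
        assert (Hp : 0 < (INR n / w) ^ N)
          by (apply pow_lt, Rdiv_lt_0_compat; lra).
        replace (w / INR n) with (/ (INR n / w)) by (field; lra).
        rewrite pow_inv. split.
        -- left. apply Rinv_0_lt_compat. lra.
        -- apply Rinv_le_contravar; lra.
      * apply is_lim_seq_const.
      * apply is_lim_seq_geom. rewrite Rabs_pos_eq.
        -- apply Rlt_div_l; lra.
        -- apply Rdiv_le_0_compat; lra.
    + apply is_lim_seq_ext with (fun _ => / 2); [|apply is_lim_seq_const].
      intros N. rewrite cutoff_inv by trivial.
      replace (INR n / w) with 1 by (replace (INR n) with w by lra; field; lra).
      rewrite pow1. f_equal; lra.
Qed.

(** Beyond [w] the cutoff is at most [(w / n) ^ N], which beats [n ^ p] by two
    powers as soon as [N >= p + 2]. *)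
Lemma cutoff_dominated (w : R) (p N n : nat) :
  0 < w -> w <= INR n -> (p + 2 <= N)%nat ->
  Rabs (INR n ^ p * cutoff w N n) <= w ^ (p + 2) / INR n ^ 2.
Proof.
  intros Hw Hn HN.
  assert (Hp : forall m, 0 < INR n ^ m) by (intros; apply pow_lt; lra).
  assert (Hpw : forall m, 0 < w ^ m) by (intros; now apply pow_lt).
  rewrite cutoff_inv by trivial.
  assert (Hge1 : 1 <= INR n / w) by (apply Rle_div_r; lra).
  assert (H1 : (INR n / w) ^ (p + 2) <= (INR n / w) ^ N) by (apply Rle_pow; trivial).
  assert (H0 : 0 < (INR n / w) ^ (p + 2)) by (apply pow_lt; lra).
  rewrite Rabs_pos_eq.
  - replace (w ^ (p + 2) / INR n ^ 2) with (INR n ^ p * / (INR n / w) ^ (p + 2)).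
    + apply Rmult_le_compat_l; [apply Rlt_le, Hp|].
      apply Rinv_le_contravar; lra.
    + unfold Rdiv. rewrite Rpow_mult_distr, pow_inv, (pow_add (INR n)).
      assert (A := Hpw (p + 2)%nat). assert (B := Hp p). field. lra.
  - apply Rmult_le_pos; [apply Rlt_le, Hp|]. left. apply Rinv_0_lt_compat. lra.
Qed.

Lemma sum_n_RtoC (a : nat -> R) (n : nat) :
  sum_n (fun i => RtoC (a i)) n = RtoC (sum_n a n).
Proof.
  induction n as [|n IH].
  - now rewrite !sum_O.
  - rewrite sum_Sn_R, sum_Sn_C, IH. symmetry. apply RtoC_plus.
Qed.

(** The sum of the [n ^ p] weighted by [cutoff_lim]. It is written with the sum up
    to the integer part included, so that a correction is needed only when [w] is
    an integer. *)
Definition power_sum_lim (w : R) (p : nat) : R :=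
  let K := Z.to_nat (Int_part w) in
  sum_n (fun n => INR n ^ p) K - (if is_integer_dec w then INR K ^ p / 2 else 0).

Lemma INR_Int_part (w : R) : 0 <= w ->
  INR (Z.to_nat (Int_part w)) = IZR (Int_part w).
Proof.
  intros Hw. destruct (base_Int_part w) as [H1 H2].
  assert (-1 < Int_part w)%Z by (apply lt_IZR; simpl; lra).
  rewrite INR_IZR_INZ, Z2Nat.id; [reflexivity|lia].
Qed.

Lemma sum_cutoff_lim (w : R) (p m : nat) : 0 < w ->
  (Z.to_nat (Int_part w) <= m)%nat ->
  (sum_n (fun n => INR n ^ p * cutoff_lim w n) m : R) = power_sum_lim w p.
Proof.
  intros Hw. unfold power_sum_lim.
  assert (HK := INR_Int_part w (Rlt_le _ _ Hw)).
  destruct (base_Int_part w) as [B1 B2].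
  set (K := Z.to_nat (Int_part w)) in *. rewrite <- HK in B1, B2.
  intros Hm. induction Hm as [|m Hm IH].
  - assert (Hlt : forall n, (n < K)%nat -> INR n ^ p * cutoff_lim w n = INR n ^ p).
    { intros n Hn. apply lt_INR in Hn. unfold cutoff_lim.
      destruct (Rlt_dec (INR n) w); lra. }
    assert (HKK : INR K ^ p * cutoff_lim w K
                  = INR K ^ p - (if is_integer_dec w then INR K ^ p / 2 else 0)).
    { unfold cutoff_lim. destruct (is_integer_dec w) as [Hi|Hi].
      - assert (E : w = INR K).
        { destruct Hi as [z Hz]. rewrite HK, Hz. f_equal.
          apply Int_part_spec. lra. }
        destruct (Rlt_dec (INR K) w); [lra|].
        destruct (Rlt_dec w (INR K)); lra.
      - destruct (Rlt_dec (INR K) w) as [H|H]; [lra|].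
        exfalso. apply Hi. exists (Int_part w). lra. }
    destruct K as [|K'].
    + rewrite !sum_O, HKK. reflexivity.
    + rewrite !sum_Sn_R, HKK.
      rewrite (sum_n_ext_loc _ (fun n => INR n ^ p) K'); [ring|].
      intros n Hn. apply Hlt. lia.
  - rewrite sum_Sn_R, IH. unfold cutoff_lim at 1.
    assert (H : INR K + 1 <= INR (S m))
      by (rewrite <- S_INR; apply le_INR; lia).
    destruct (Rlt_dec (INR (S m)) w); [lra|].
    destruct (Rlt_dec w (INR (S m))); [ring|lra].
Qed.

(** The common analytic core of the three limits; [N k] will be [2k] or [2k + 1].
    The [k]-th series is identified by its sum [S k], since these sums are what
    the averages of cotangents and digamma values compute. *)
Theorem cutoff_power_sum (w : R) (p : nat) (S : nat -> C) (N : nat -> nat) :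
  0 < w -> filterlim N eventually eventually ->
  eventually (fun k => is_lim_Cseq
    (sum_n (fun n => RtoC (INR n ^ p * cutoff w (N k) n))) (S k)) ->
  is_lim_Cseq S (RtoC (power_sum_lim w p)).
Proof.
  intros Hw HN [k1 HS].
  destruct (HN (fun m => (p + 2 <= m)%nat)) as [k2 Hk2]; [now exists (p + 2)%nat|].
  destruct (nfloor_ex w (Rlt_le _ _ Hw)) as [n1 [_ Hn1]].
  destruct (dominated_convergence_sum
    (fun k n => RtoC (INR n ^ p * cutoff w (N k) n))
    (fun n => RtoC (INR n ^ p * cutoff_lim w n)) S
    (fun n => w ^ (p + 2) / INR n ^ 2) (Datatypes.S n1) (max k1 k2))
    as [s [Hs HSs]].
  - intros k n Hk Hn. rewrite Cmod_R. apply cutoff_dominated; trivial.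
    + apply Rlt_le, Rlt_le_trans with (1 := Hn1). rewrite <- S_INR.
      now apply le_INR.
    + apply Hk2. lia.
  - apply ex_series_scal_inv_sqr.
  - intros n. apply is_lim_Cseq_RtoC, is_lim_seq_mult';
      [apply is_lim_seq_const|].
    apply (is_lim_seq_subseq (fun N => cutoff w N n)); trivial.
    now apply is_lim_cutoff.
  - intros k Hk. apply HS. lia.
  - replace (RtoC (power_sum_lim w p)) with s; trivial.
    apply (is_lim_Cseq_unique _ _ _ Hs).
    apply is_lim_Cseq_ext_loc with (fun _ => RtoC (power_sum_lim w p));
      [|apply is_lim_Cseq_const].
    exists (Z.to_nat (Int_part w)). intros m Hm.
    now rewrite sum_n_RtoC, sum_cutoff_lim.
Qed.

(** * Bernoulli polynomials and power sums *)
Lemma is_derive_sum_f_R0 (f : nat -> R -> R) (f' : nat -> R) (x : R) (n : nat) :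
  (forall j, (j <= n)%nat -> is_derive (f j) x (f' j)) ->
  is_derive (fun t => sum_f_R0 (fun j => f j t) n) x (sum_f_R0 f' n).
Proof.
  induction n as [|n IH]; intros H; simpl.
  - now apply H.
  - apply @is_derive_plus; [apply IH; intros|]; apply H; lia.
Qed.

Lemma binomial_absorb (m j : nat) : (j <= m)%nat ->
  Binomial.C (S m) j * INR (S m - j) = INR (S m) * Binomial.C m j.
Proof.
  intros Hj. unfold Binomial.C.
  replace (S m - j)%nat with (S (m - j)) by lia.
  rewrite !fact_simpl, !mult_INR.
  field. repeat split; try apply INR_fact_neq_0; apply not_0_INR; lia.
Qed.

Lemma is_derive_bernoulli_poly (m : nat) (x : R) :
  is_derive (bernoulli_poly (S m)) x (INR (S m) * bernoulli_poly m x).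
Proof.
  unfold bernoulli_poly at 1.
  evar_last.
  - apply is_derive_sum_f_R0 with
      (f' := fun j => Binomial.C (S m) j * bernoulli j
                      * (INR (S m - j) * x ^ pred (S m - j))).
    intros j Hj.
    generalize (S m - j)%nat. intros d. auto_derive; [trivial|]. ring.
  - rewrite tech5, Nat.sub_diag. unfold bernoulli_poly.
    rewrite scal_sum, (sum_eq _ (fun j => Binomial.C m j * bernoulli j
      * x ^ (m - j) * INR (S m))).
    + simpl (INR 0). ring.
    + intros j Hj. replace (pred (S m - j)) with (m - j)%nat by lia.
      transitivity (Binomial.C (S m) j * INR (S m - j)
                    * (bernoulli j * x ^ (m - j))); [ring|].
      rewrite binomial_absorb by trivial. ring.
Qed.

(** This is the recurrence of the Bernoulli numbers; [0 ^ m] records the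
    exceptional case [B_1 (1) = B_1 + 1]. *)
Lemma bernoulli_poly_1 (m : nat) :
  bernoulli_poly (S m) 1 = bernoulli (S m) + INR (S m) * 0 ^ m.
Proof.
  unfold bernoulli_poly. rewrite tech5, C_n_n, pow1.
  rewrite (sum_eq _ (fun j => Binomial.C (m + 1) j * bernoulli j)).
  2:{ intros j _. rewrite pow1, Nat.add_1_r. ring. }
  destruct m as [|m].
  - simpl. unfold bernoulli at 1; simpl bernoulli_upto.
    rewrite pascal_step1, Nat.sub_0_r, C_n_n by lia. ring.
  - rewrite bernoulli_rec by lia. rewrite pow_ne_zero by lia. ring.
Qed.

(** By induction on [m]: the derivative of the difference of the two sides is a
    multiple of the same difference in degree [m - 1], hence vanishes, and the
    two sides agree at 0 by the recurrence. *)
Lemma bernoulli_poly_diff (m : nat) (x : R) :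
  bernoulli_poly (S m) (x + 1) - bernoulli_poly (S m) x = INR (S m) * x ^ m.
Proof.
  revert x. induction m as [m IH] using lt_wf_ind. intros x.
  set (D := fun t => bernoulli_poly (S m) (t + 1) - bernoulli_poly (S m) t
                     - INR (S m) * t ^ m).
  assert (HD : forall t, is_derive D t 0).
  { intros t. unfold D. evar_last.
    - apply @is_derive_minus; [apply @is_derive_minus|].
      + apply (is_derive_comp (bernoulli_poly (S m)) (fun t => t + 1)).
        * apply is_derive_bernoulli_poly.
        * auto_derive; [trivial|reflexivity].
      + apply is_derive_bernoulli_poly.
      + apply is_derive_scal. auto_derive; [trivial|reflexivity].
    - unfold minus, plus, opp, scal, mult; simpl; unfold mult; simpl.
      destruct m as [|m].
      + unfold bernoulli_poly; simpl. ring.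
      + specialize (IH m ltac:(lia) t). rewrite S_INR in *.
        simpl pred. simpl (INR (S m)) in IH.
        nra. }
  assert (H0 : D 0 = 0).
  { unfold D. rewrite Rplus_0_l, bernoulli_poly_1, bernoulli_poly_0. ring. }
  (* The mean value theorem on the interval between 0 and [x]. *)
  assert (Hx : D x = D 0).
  { destruct (MVT_gen D 0 x (fun _ => 0)) as [c [_ Hc]].
    - intros; apply HD.
    - intros t _. apply derivable_continuous_pt. exists 0.
      now apply is_derive_Reals.
    - lra. }
  unfold D at 1 in Hx. lra.
Qed.

Lemma bernoulli_power_sum (l K : nat) : (1 <= l)%nat ->
  (sum_n (fun n => INR n ^ l) K : R)
  = (bernoulli_poly (S l) (INR K) - bernoulli (S l)) / INR (S l) + INR K ^ l.
Proof.
  intros Hl. assert (HS : INR (S l) <> 0) by (apply not_0_INR; lia).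
  induction K as [|K IH].
  - rewrite sum_O. simpl (INR 0). rewrite bernoulli_poly_0, pow_ne_zero by lia.
    field. exact HS.
  - rewrite sum_Sn_R, IH.
    assert (H := bernoulli_poly_diff l (INR K)). rewrite <- S_INR in H.
    replace (bernoulli_poly (S l) (INR (S K)))
      with (bernoulli_poly (S l) (INR K) + INR (S l) * INR K ^ l) by lra.
    field. exact HS.
Qed.

(** * Complete systems of roots *)

Definition cis (t : R) : C := (cos t, sin t).

Lemma cis_add (s t : R) : cis (s + t) = (cis s * cis t)%C.
Proof.
  unfold cis. rewrite cos_plus, sin_plus.
  apply injective_projections; simpl; ring.
Qed.

Lemma cis_0 : cis 0 = 1.
Proof. unfold cis. now rewrite cos_0, sin_0. Qed.

Lemma cis_PI : cis PI = (-(1))%C.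
Proof.
  unfold cis. rewrite cos_PI, sin_PI.
  apply injective_projections; simpl; ring.
Qed.

Lemma cis_pow (t : R) (n : nat) : (cis t ^ n)%C = cis (INR n * t).
Proof.
  induction n as [|n IH].
  - simpl. now rewrite Rmult_0_l, cis_0.
  - rewrite Cpow_S, IH, <- cis_add, S_INR. f_equal. ring.
Qed.

Lemma cis_2PI_mult (n : nat) : cis (INR n * (2 * PI)) = 1.
Proof.
  rewrite <- cis_pow. unfold cis. rewrite cos_2PI, sin_2PI. apply Cpow_1_l.
Qed.

Lemma cis_neq_1 (t : R) : 0 < t < 2 * PI -> cis t <> 1.
Proof.
  intros Ht E. assert (Ec : cos t = 1) by exact (f_equal fst E).
  replace t with (2 * (t / 2)) in Ec by field. rewrite cos_2a_sin in Ec.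
  assert (0 < sin (t / 2)) by (apply sin_gt_0; lra). nra.
Qed.

Lemma geometric_sum_C (y u : C) (n : nat) :
  ((y - u) * sum_n (fun j => y ^ (n - j) * u ^ j)%C n)%C
  = (y ^ S n - u ^ S n)%C.
Proof.
  induction n as [|n IH].
  - rewrite sum_O. simpl. ring.
  - rewrite sum_Sn_C, Nat.sub_diag.
    rewrite (sum_n_ext_C _ (fun j => y * (y ^ (n - j) * u ^ j))%C n).
    + rewrite sum_n_mult_l_C.
      transitivity (y * ((y - u) * sum_n (fun j => y ^ (n - j) * u ^ j)%C n)
                    + (y - u) * u ^ S n)%C.
      * ring.
      * rewrite IH. simpl. ring.
    + intros j Hj. replace (S n - j)%nat with (S (n - j)) by lia.
      rewrite Cpow_S. symmetry. apply Cmult_assoc.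
Qed.

(** The [N] roots of [x ^ N = c], for [c <> 0]. Distinctness is replaced by the
    vanishing of the power sums, which is the only consequence of it that
    averaging uses. *)
Definition root_system (N : nat) (c : C) (zeta : nat -> C) : Prop :=
  (forall r, zeta r ^ N = c)%C /\
  (forall p, (0 < p < N)%nat -> (sum_n (fun r => zeta r ^ p)%C (N - 1) : C) = RtoC 0).

(** The power sum of exponent [p] is geometric with ratio [q = cis (2 pi p / N)],
    a root of unity other than 1. *)
Lemma root_system_cis (N : nat) (b : R) : (0 < N)%nat ->
  root_system N (cis (INR N * b)) (fun r => cis (b + 2 * PI * INR r / INR N)).
Proof.
  intros HN. assert (HN' : 0 < INR N) by now apply lt_0_INR.
  split.
  - intros r. rewrite cis_pow.
    replace (INR N * (b + 2 * PI * INR r / INR N))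
      with (INR N * b + INR r * (2 * PI)) by (field; lra).
    rewrite cis_add, cis_2PI_mult. ring.
  - intros p Hp.
    set (q := cis (2 * PI * INR p / INR N)).
    assert (Hp' : 0 < INR p < INR N) by (split; [apply lt_0_INR | apply lt_INR]; lia).
    assert (Hq : q <> 1).
    { apply cis_neq_1. assert (HPI := PI_RGT_0). split.
      - apply Rdiv_lt_0_compat; nra.
      - apply Rlt_div_l; nra. }
    assert (HqN : (q ^ N)%C = 1).
    { unfold q. rewrite cis_pow.
      replace (INR N * (2 * PI * INR p / INR N)) with (INR p * (2 * PI))
        by (field; lra).
      apply cis_2PI_mult. }
    rewrite (sum_n_ext_C _ (fun r => cis (INR p * b) * q ^ r)%C).
    2:{ intros r _. unfold q. rewrite !cis_pow. rewrite <- cis_add. f_equal. field. lra. }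
    rewrite sum_n_mult_l_C.
    assert (G := geometric_sum_C 1 q (N - 1)).
    replace (S (N - 1)) with N in G by lia.
    rewrite HqN, Cpow_1_l in G.
    rewrite (sum_n_ext_C _ (Cpow q)) in G
      by (intros; rewrite Cpow_1_l; ring).
    replace (sum_n (Cpow q) (N - 1)) with (RtoC 0);
      [ring|].
    assert (H1 : (1 - q)%C <> 0).
    { intros E. apply Hq. replace q with (1 - (1 - q))%C by ring.
      rewrite E. ring. }
    replace (sum_n (Cpow q) (N - 1))
      with (/ (1 - q) * ((1 - q) * sum_n (Cpow q) (N - 1)))%C
      by (field; exact H1).
    rewrite G. ring.
Qed.

Lemma sum_n_single (a : nat -> C) (n i : nat) : (i <= n)%nat ->
  (forall j, (j <= n)%nat -> j <> i -> a j = RtoC 0) -> (sum_n a n : C) = a i.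
Proof.
  intros Hi. induction Hi as [|n Hi IH]; intros H.
  - destruct i as [|i]; [now rewrite sum_O|].
    rewrite sum_Sn_C, (sum_n_ext_C _ (fun _ => zero)).
    + unfold sum_n. rewrite sum_n_m_const_zero. unfold zero; simpl. ring.
    + intros j Hj. apply H; lia.
  - rewrite sum_Sn_C, IH, (H (S n)) by (intros; try apply H; lia). ring.
Qed.

Lemma sum_n_const_C (a : C) (n : nat) :
  (sum_n (fun _ => a) n : C) = (INR (S n) * a)%C.
Proof.
  induction n as [|n IH].
  - rewrite sum_O. simpl. ring.
  - rewrite sum_Sn_C, IH, (S_INR (S n)), RtoC_plus. ring.
Qed.

(** Since [y ^ N - c w ^ N] is divisible by [y - zeta w], with quotient
    [sum_j y ^ (N - 1 - j) (zeta w) ^ j], the left side is a combination of the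
    power sums of exponents [m + j]. These exponents run over [N] consecutive
    integers below [2 N], and only [m + j = N] contributes. The form without
    [1 / y] allows [y = 0], which is needed for the pole at 0. *)
Theorem root_system_partial_fraction (N m : nat) (c y w : C) (zeta : nat -> C) :
  root_system N c zeta -> (1 <= m <= N)%nat -> (y ^ N - c * w ^ N)%C <> 0 ->
  (sum_n (fun r => zeta r ^ m / (y - zeta r * w))%C (N - 1) : C)
  = (INR N * c * w ^ (N - m) * y ^ (m - 1) / (y ^ N - c * w ^ N))%C.
Proof.
  intros [Hc Hp] Hm HD. set (D := (y ^ N - c * w ^ N)%C) in *.
  assert (G : forall r, ((y - zeta r * w)
      * sum_n (fun j => y ^ (N - 1 - j) * (zeta r * w) ^ j) (N - 1) = D)%C).
  { intros r. rewrite geometric_sum_C. replace (S (N - 1)) with N by lia.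
    now rewrite Cpow_mult_l, Hc. }
  rewrite (sum_n_ext_C _ (fun r => sum_n (fun j =>
    y ^ (N - 1 - j) * w ^ j / D * zeta r ^ (m + j))%C (N - 1))).
  2:{ intros r _.
      transitivity (zeta r ^ m / D *
        sum_n (fun j => y ^ (N - 1 - j) * (zeta r * w) ^ j) (N - 1))%C.
      - rewrite <- (G r) at 1. field.
        assert (HG := HD). rewrite <- (G r) in HG.
        split; intros E; apply HG; rewrite E; ring.
      - rewrite <- sum_n_mult_l_C. apply sum_n_ext_C. intros j _.
        rewrite Cpow_mult_l, Cpow_add_r. field. exact HD. }
  rewrite sum_n_switch.
  rewrite (sum_n_single _ _ (N - m)).
  - replace (m + (N - m))%nat with N by lia.
    rewrite (sum_n_ext_C _ (fun _ => y ^ (N - 1 - (N - m)) * w ^ (N - m) / D * c)%C)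
      by (intros r _; now rewrite Hc).
    rewrite sum_n_const_C. replace (S (N - 1)) with N by lia.
    replace (N - 1 - (N - m))%nat with (m - 1)%nat by lia. field. exact HD.
  - lia.
  - intros j Hj Hne.
    rewrite sum_n_mult_l_C.
    replace (sum_n (fun r => zeta r ^ (m + j))%C (N - 1)) with (RtoC 0);
      [ring|].
    symmetry. destruct (Nat.lt_ge_cases (m + j) N) as [H|H].
    + apply Hp. lia.
    + rewrite (sum_n_ext_C _ (fun r => c * zeta r ^ (m + j - N))%C).
      * rewrite sum_n_mult_l_C, Hp by lia. ring.
      * intros r _. rewrite <- (Hc r). rewrite <- Cpow_add_r. f_equal. lia.
Qed.

(** * The complex exponential *)
Lemma RtoC_neq (x y : R) : x <> y -> RtoC x <> RtoC y.
Proof. intros H E. now apply H, RtoC_inj. Qed.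

Lemma Cexp_add (a b : C) : Cexp (a + b) = (Cexp a * Cexp b)%C.
Proof.
  unfold Cexp. replace (Re (a + b)) with (Re a + Re b) by reflexivity.
  replace (Im (a + b)) with (Im a + Im b) by reflexivity.
  rewrite exp_plus, cos_plus, sin_plus.
  apply injective_projections; simpl; ring.
Qed.

Lemma Cexp_cis (t : R) : Cexp (Ci * t) = cis t.
Proof.
  unfold Cexp, cis. replace (Re (Ci * t)) with 0 by (simpl; ring).
  replace (Im (Ci * t)) with t by (simpl; ring).
  rewrite exp_0. apply injective_projections; simpl; ring.
Qed.

Lemma Cexp_0 : Cexp 0 = 1.
Proof. rewrite <- cis_0, <- Cexp_cis. f_equal. ring. Qed.

Lemma Cexp_opp_mult (z : C) : (Cexp z * Cexp (- z))%C = 1.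
Proof.
  rewrite <- Cexp_add, <- Cexp_0. f_equal. ring.
Qed.

Lemma Cexp_neq_0 (z : C) : Cexp z <> 0.
Proof.
  intros E. assert (H := Cexp_opp_mult z). rewrite E, Cmult_0_l in H.
  now apply C1_nz.
Qed.

Lemma Cexp_opp (z : C) : Cexp (- z) = (/ Cexp z)%C.
Proof.
  assert (H := Cexp_opp_mult z). assert (H' := Cexp_neq_0 z).
  transitivity (/ Cexp z * (Cexp z * Cexp (- z)))%C; [field; exact H'|].
  rewrite H. ring.
Qed.

Lemma Cexp_pow (z : C) (n : nat) : (Cexp z ^ n)%C = Cexp (INR n * z).
Proof.
  induction n as [|n IH].
  - simpl. rewrite <- Cexp_0. f_equal. ring.
  - rewrite Cpow_S, IH, <- Cexp_add, S_INR, RtoC_plus. f_equal. ring.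
Qed.

Lemma Cmod_Cexp (z : C) : Cmod (Cexp z) = exp (Re z).
Proof.
  unfold Cmod, Cexp; simpl.
  replace (_ + _) with ((exp (Re z)) ^ 2).
  - apply sqrt_pow2, Rlt_le, exp_pos.
  - assert (H := sin2_cos2 (Im z)). unfold Rsqr in H.
    transitivity (exp (Re z) ^ 2 * (sin (Im z) * sin (Im z) + cos (Im z) * cos (Im z)));
      [rewrite H|]; ring.
Qed.

(** * Second-order estimates at 0 *)

(** The upper bound comes from [exp (- x) >= 1 - x], that is
    [exp x <= 1 / (1 - x)]. *)
Lemma exp_taylor_1 (x : R) : Rabs x <= / 2 -> Rabs (exp x - 1 - x) <= 2 * x ^ 2.
Proof.
  intros Hx. apply Rabs_le_between in Hx.
  assert (H1 := exp_ineq1_le x). assert (H2 := exp_ineq1_le (- x)).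
  assert (H3 : exp x * exp (- x) = 1)
    by (rewrite <- exp_plus, Rplus_opp_r; apply exp_0).
  assert (H4 := exp_pos x).
  rewrite Rabs_pos_eq by lra.
  assert (exp x * (1 - x) <= 1) by nra.
  assert (exp x * (1 - x) <= (1 + x + 2 * x ^ 2) * (1 - x)) by nra.
  assert (exp x <= 1 + x + 2 * x ^ 2)
    by (apply Rmult_le_reg_r with (1 - x); lra).
  lra.
Qed.

Lemma sin_taylor_1 (y : R) : Rabs y <= 1 -> Rabs (sin y - y) <= y ^ 2 / 6.
Proof.
  assert (Hp : forall t, 0 <= t <= 1 -> t - t ^ 3 / 6 <= sin t <= t).
  { intros t Ht. split.
    - assert (H := proj1 (pre_sin_bound t 0 ltac:(lra) ltac:(lra))).
      unfold sin_approx, sin_term in H. simpl in H. lra.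
    - destruct (Req_dec t 0) as [->|H]; [rewrite sin_0; lra|].
      left. apply sin_lt_x. lra. }
  intros Hy. apply Rabs_le_between in Hy. apply Rabs_le_between.
  destruct (Rle_dec 0 y) as [H|H].
  - specialize (Hp y ltac:(lra)). nra.
  - specialize (Hp (- y) ltac:(lra)). rewrite sin_neg in Hp. nra.
Qed.

Lemma cos_taylor_1 (y : R) : Rabs y <= 1 -> 0 <= 1 - cos y <= y ^ 2.
Proof.
  intros Hy. split; [assert (H := COS_bound y); lra|].
  assert (H : Rabs (y / 2) <= 1)
    by (unfold Rdiv; rewrite Rabs_mult, (Rabs_pos_eq (/ 2)) by lra; lra).
  assert (H' := sin_taylor_1 _ H). apply Rabs_le_between in H, H'.
  replace y with (2 * (y / 2)) at 1 by field. rewrite cos_2a_sin.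
  set (t := y / 2) in *. replace (y ^ 2) with (4 * t ^ 2) by (unfold t; field).
  set (d := sin t - t) in *. replace (sin t) with (t + d) by (unfold d; ring).
  assert (Ht : t ^ 2 <= 1) by nra.
  assert (Hd : d ^ 2 <= t ^ 2 / 36) by nra.
  assert (Hs := pow2_ge_0 (t - 2 * d)). nra.
Qed.

Lemma Cmod_components_le (z : C) : Cmod z <= Rabs (Re z) + Rabs (Im z).
Proof.
  destruct z as [x y].
  replace (x, y) with (RtoC x + Ci * RtoC y)%C
    by (apply injective_projections; simpl; ring).
  eapply Rle_trans; [apply Cmod_triangle|].
  rewrite Cmod_mult, Cmod_Ci, !Cmod_R.
  replace (Re _) with x by (simpl; ring). replace (Im _) with y by (simpl; ring).
  lra.
Qed.

Lemma Cexp_taylor_1 (u : C) : Cmod u <= / 2 ->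
  Cmod (Cexp u - 1 - u) <= 4 * Cmod u ^ 2.
Proof.
  intros Hu.
  assert (Hx := Rle_trans _ _ _ (re_le_Cmod u) Hu).
  assert (Hy := Rle_trans _ _ _ (im_le_Cmod u) Hu).
  eapply Rle_trans; [apply Cmod_components_le|].
  rewrite Cmod2_alt.
  replace (Re (Cexp u - 1 - u)) with (exp (Re u) * cos (Im u) - 1 - Re u)
    by (unfold Cexp, Re, Im; simpl; ring).
  replace (Im (Cexp u - 1 - u)) with (exp (Re u) * sin (Im u) - Im u)
    by (unfold Cexp, Re, Im; simpl; ring).
  set (x := Re u) in *. set (y := Im u) in *.
  assert (E := exp_taylor_1 x Hx).
  assert (S := sin_taylor_1 y ltac:(lra)).
  assert (K := cos_taylor_1 y ltac:(lra)).
  assert (Ep := exp_pos x).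
  apply Rabs_le_between in E, S, Hx, Hy.
  destruct E as [E0 E1], S as [S0 S1], Hx as [Hx0 Hx1], Hy as [Hy0 Hy1].
  assert (E2 : exp x <= 2) by nra.
  assert (A : Rabs (exp x * cos y - 1 - x) <= 2 * x ^ 2 + 2 * y ^ 2).
  { apply Rabs_le_between.
    replace (exp x * cos y - 1 - x)
      with ((exp x - 1 - x) - exp x * (1 - cos y)) by ring.
    assert (0 <= exp x * (1 - cos y) <= 2 * y ^ 2) by (split; nra).
    nra. }
  assert (B : Rabs (exp x * sin y - y) <= 2 * x ^ 2 + 2 * y ^ 2).
  { apply Rabs_le_between.
    replace (exp x * sin y - y)
      with (x * y + (exp x - 1 - x) * y + exp x * (sin y - y)) by ring.
    assert (- (x ^ 2 + y ^ 2) / 2 <= x * y <= (x ^ 2 + y ^ 2) / 2)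
      by (assert (P := pow2_ge_0 (x + y)); assert (Q := pow2_ge_0 (x - y));
          split; nra).
    assert (- x ^ 2 <= (exp x - 1 - x) * y <= x ^ 2) by (split; nra).
    assert (- (y ^ 2 / 3) <= exp x * (sin y - y) <= y ^ 2 / 3) by (split; nra).
    nra. }
  lra.
Qed.

(** * The cotangent *)

Lemma Ci2 : (Ci * Ci)%C = (- (1))%C.
Proof. apply injective_projections; simpl; ring. Qed.

Lemma Csin_add (a b : C) :
  Csin (a + b) = (Csin a * Ccos b + Ccos a * Csin b)%C.
Proof.
  unfold Csin, Ccos. rewrite !Cexp_opp.
  replace (Ci * (a + b))%C with (Ci * a + Ci * b)%C by ring.
  rewrite Cexp_add. field.
  repeat split; try apply Cexp_neq_0; apply Ci_nz.
Qed.

(** [Re (sin (x + i y)) = sin x cosh y]. *)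
Lemma Csin_ge_sin (t : C) : Rabs (sin (Re t)) <= Cmod (Csin t).
Proof.
  eapply Rle_trans; [|apply re_le_Cmod].
  replace (Re (Csin t))
    with (sin (Re t) * ((exp (Im t) + exp (- Im t)) / 2)).
  - assert (H1 := exp_ineq1_le (Im t)). assert (H2 := exp_ineq1_le (- Im t)).
    rewrite Rabs_mult, (Rabs_pos_eq (_ / 2)) by lra.
    assert (H := Rabs_pos (sin (Re t))). nra.
  - unfold Csin.
    replace ((Cexp (Ci * t) - Cexp (- (Ci * t))) / (2 * Ci))%C
      with (/ 2 * (Ci * (Cexp (- (Ci * t)) - Cexp (Ci * t))))%C.
    2:{ transitivity (/ 2 * ((- (Ci * Ci)) * (Cexp (Ci * t) - Cexp (- (Ci * t))) / Ci))%C.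
        - field. apply Ci_nz.
        - rewrite Ci2. field. apply Ci_nz. }
    unfold Cexp.
    replace (Re (Ci * t)) with (- Im t) by (unfold Re, Im; simpl; ring).
    replace (Im (Ci * t)) with (Re t) by (unfold Re, Im; simpl; ring).
    replace (Re (- (Ci * t))) with (Im t) by (unfold Re, Im; simpl; ring).
    replace (Im (- (Ci * t))) with (- Re t) by (unfold Re, Im; simpl; ring).
    rewrite cos_neg, sin_neg. generalize (Re t) (Im t). intros x y.
    unfold Re; simpl. field.
Qed.

Lemma Cexp_neq_1 (z : C) : Re z <> 0 -> (1 - Cexp z)%C <> 0.
Proof.
  intros Hz E. apply Hz.
  assert (H : Cexp z = 1)
    by (replace (Cexp z) with (1 - (1 - Cexp z))%C by ring; rewrite E; ring).
  apply (f_equal Cmod) in H. rewrite Cmod_Cexp, Cmod_1, <- exp_0 in H.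
  now apply exp_inv.
Qed.

Lemma Re_2Ci_mult (t : C) : Re (2 * Ci * t) = - 2 * Im t.
Proof. unfold Re, Im; simpl; ring. Qed.

(** In this form a translation of [t] multiplies [exp (2 i t)] by a constant, so
    that sums of translates of the cotangent become sums over roots of unity. *)
Lemma Ccot_Cexp (t : C) : Im t <> 0 ->
  Ccot t = (Ci - 2 * Ci / (1 - Cexp (2 * Ci * t)))%C.
Proof.
  intros Ht.
  assert (H : (1 - Cexp (2 * Ci * t))%C <> 0)
    by (apply Cexp_neq_1; rewrite Re_2Ci_mult; lra).
  revert H. unfold Ccot, Ccos, Csin. rewrite Cexp_opp.
  replace (2 * Ci * t)%C with (Ci * t + Ci * t)%C by ring. rewrite Cexp_add.
  assert (He := Cexp_neq_0 (Ci * t)). set (e := Cexp (Ci * t)) in *. intros H.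
  field. repeat split; trivial; try apply Ci_nz.
  intros E. apply H. transitivity (- (e * e - 1))%C; [ring|rewrite E; ring].
Qed.

Lemma Ccot_add_sub (t b : C) : Csin (t + b) <> 0 -> Csin (t - b) <> 0 ->
  (Ccot (t + b) + Ccot (t - b) = Csin (2 * t) / (Csin (t + b) * Csin (t - b)))%C.
Proof.
  intros H1 H2. unfold Ccot.
  replace (2 * t)%C with ((t + b) + (t - b))%C by ring. rewrite (Csin_add (t + b)).
  field. now split.
Qed.

Lemma sum_n_shift_C (a : nat -> C) (n : nat) :
  (sum_n a (S n) : C) = (a O + sum_n (fun j => a (S j)) n)%C.
Proof.
  induction n as [|n IH].
  - now rewrite sum_Sn_C, !sum_O.
  - rewrite sum_Sn_C, IH, (sum_Sn_C (fun j => a (S j))). ring.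
Qed.

(** Pairs the indices symmetric about the middle one, which is counted twice on
    the left. *)
Lemma sum_n_fold (m : nat) (G : nat -> C) :
  (sum_n (fun i => G (m + i)%nat + G (m - i)%nat)%C m : C)
  = (sum_n G (2 * m) + G m)%C.
Proof.
  revert G. induction m as [|m IH]; intros G.
  - simpl. now rewrite !sum_O.
  - rewrite sum_Sn_C.
    rewrite (sum_n_ext_C _ (fun i => G (S (m + i)) + G (S (m - i)))%C).
    2:{ intros i Hi. replace (S m - i)%nat with (S (m - i)) by lia. reflexivity. }
    rewrite (IH (fun j => G (S j))).
    replace (2 * S m)%nat with (S (S (2 * m))) by lia.
    rewrite sum_Sn_C, sum_n_shift_C.
    replace (S m + S m)%nat with (S (S (2 * m))) by lia.
    rewrite Nat.sub_diag. ring.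
Qed.

(** With [u = exp (2 i t)] this is the partial fraction of [1 / (1 - u ^ N)] over
    the [N]-th roots of unity, [N = 2 m + 1]. The term [cot t] on the left
    compensates for the index [i = 0], which occurs twice on the right. *)
Lemma Ccot_multiple (m : nat) (t : C) : Im t <> 0 ->
  (INR (2 * m + 1) * Ccot (INR (2 * m + 1) * t) + Ccot t)%C
  = sum_n (fun i => Ccot (t + PI * INR i / INR (2 * m + 1))
                    + Ccot (t - PI * INR i / INR (2 * m + 1)))%C m.
Proof.
  intros Ht. set (N := (2 * m + 1)%nat).
  assert (HN : 0 < INR N) by (apply lt_0_INR; lia).
  assert (HNC : RtoC (INR N) <> 0)
    by (intros H; injection H; clear - HN; intros H; lra).
  (* This starting angle indexes the roots of unity from [- m] to [m]; it is a
     multiple of [2 pi / N], so the [N]-th powers are still 1. *)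
  set (b := - (2 * PI * INR m / INR N)).
  assert (Hroot := root_system_cis N b ltac:(lia)).
  assert (Hone : cis (INR N * b) = 1).
  { assert (H := cis_2PI_mult m).
    assert (H' : (cis (INR N * b) * cis (INR m * (2 * PI)))%C = 1).
    { rewrite <- cis_add, <- cis_0. f_equal. unfold b. field. lra. }
    rewrite H in H'. rewrite <- H'. ring. }
  rewrite Hone in Hroot.
  set (u := Cexp (2 * Ci * t)).
  assert (Hu : (u ^ N)%C = Cexp (2 * Ci * (INR N * t))).
  { unfold u. rewrite Cexp_pow. f_equal. ring. }
  assert (HIm : Im (INR N * t) <> 0).
  { replace (Im (INR N * t)) with (INR N * Im t) by (unfold Im; simpl; ring).
    apply Rmult_integral_contrapositive. split; [lra|exact Ht]. }
  assert (HD : (1 - u ^ N)%C <> 0).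
  { rewrite Hu. apply Cexp_neq_1. rewrite Re_2Ci_mult. lra. }
  assert (P := root_system_partial_fraction N N 1 1 u _ Hroot ltac:(lia)).
  rewrite !Cpow_1_l, Nat.sub_diag in P.
  specialize (P ltac:(now rewrite Cmult_1_l)).
  destruct Hroot as [Hpow _].
  set (G := fun j => Ccot (t + (PI * (INR j - INR m) / INR N)%R)).
  assert (HG : forall j, (j <= N - 1)%nat -> G j
     = (Ci + - (2 * Ci) * (cis (b + 2 * PI * INR j / INR N) ^ N
                / (1 - cis (b + 2 * PI * INR j / INR N) * u)))%C).
  { intros j _. rewrite Hpow. unfold G. rewrite Ccot_Cexp.
    2:{ unfold Im in *; simpl. lra. }
    replace (Cexp (2 * Ci * (t + (PI * (INR j - INR m) / INR N)%R)))
      with (cis (b + 2 * PI * INR j / INR N) * u)%C; [unfold Cdiv; ring|].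
    unfold u. rewrite <- Cexp_cis, <- Cexp_add. f_equal.
    replace (b + 2 * PI * INR j / INR N)
      with (2 * (PI * (INR j - INR m) / INR N)) by (unfold b; field; lra).
    rewrite RtoC_mult. ring. }
  transitivity (sum_n G (2 * m) + G m)%C.
  - replace (G m) with (Ccot t).
    2:{ unfold G. f_equal. rewrite Rminus_diag, Rmult_0_r. unfold Rdiv.
        rewrite Rmult_0_l. ring. }
    f_equal. replace (2 * m)%nat with (N - 1)%nat by lia.
    rewrite (sum_n_ext_C _ _ _ HG).
    rewrite Ccot_Cexp, <- Hu by exact HIm.
    transitivity (sum_n (fun _ => Ci) (N - 1)
       + - (2 * Ci) * sum_n (fun j => cis (b + 2 * PI * INR j / INR N) ^ N
                / (1 - cis (b + 2 * PI * INR j / INR N) * u))%C (N - 1))%C.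
    + rewrite P, sum_n_const_C. replace (S (N - 1)) with N by lia. simpl Cpow.
      field. exact HD.
    + rewrite <- sum_n_mult_l_C. symmetry. apply (sum_n_plus (fun _ => Ci)).
  - rewrite <- sum_n_fold. apply sum_n_ext_C. intros i Hi. unfold G.
    do 2 f_equal; unfold Cminus; f_equal.
    + rewrite plus_INR. rewrite <- RtoC_mult, <- RtoC_div by lra.
      f_equal. field. lra.
    + rewrite minus_INR by trivial.
      rewrite <- RtoC_mult, <- RtoC_div, <- RtoC_opp by lra.
      f_equal. field. lra.
Qed.

Lemma Csin_taylor_1 (u : C) : Cmod u <= / 2 ->
  Cmod (Csin u - u) <= 4 * Cmod u ^ 2.
Proof.
  intros Hu.
  assert (Hi : Cmod (Ci * u) = Cmod u) by (rewrite Cmod_mult, Cmod_Ci; ring).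
  assert (H1 := Cexp_taylor_1 (Ci * u)). assert (H2 := Cexp_taylor_1 (- (Ci * u))).
  rewrite Cmod_opp in H2. rewrite Hi in H1, H2.
  specialize (H1 Hu). specialize (H2 Hu).
  unfold Csin.
  replace ((Cexp (Ci * u) - Cexp (- (Ci * u))) / (2 * Ci) - u)%C
    with (/ (2 * Ci) * ((Cexp (Ci * u) - 1 - Ci * u)
                        - (Cexp (- (Ci * u)) - 1 - - (Ci * u))))%C
    by (field; apply Ci_nz).
  rewrite Cmod_mult, Cmod_inv, Cmod_mult, Cmod_Ci, Cmod_R, (Rabs_pos_eq 2) by
    first [lra | apply Cmult_neq_0; [apply RtoC_neq; lra | apply Ci_nz]].
  assert (T := Cmod_triangle (Cexp (Ci * u) - 1 - Ci * u)
                             (- (Cexp (- (Ci * u)) - 1 - - (Ci * u)))).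
  rewrite Cmod_opp in T. fold (Cminus (Cexp (Ci * u) - 1 - Ci * u)
                             (Cexp (- (Ci * u)) - 1 - - (Ci * u))) in T.
  lra.
Qed.

Lemma Ccos_taylor_1 (u : C) : Cmod u <= / 2 ->
  Cmod (Ccos u - 1) <= 4 * Cmod u ^ 2.
Proof.
  intros Hu.
  assert (Hi : Cmod (Ci * u) = Cmod u) by (rewrite Cmod_mult, Cmod_Ci; ring).
  assert (H1 := Cexp_taylor_1 (Ci * u)). assert (H2 := Cexp_taylor_1 (- (Ci * u))).
  rewrite Cmod_opp in H2. rewrite Hi in H1, H2.
  specialize (H1 Hu). specialize (H2 Hu).
  unfold Ccos.
  replace ((Cexp (Ci * u) + Cexp (- (Ci * u))) / 2 - 1)%C
    with (/ 2 * ((Cexp (Ci * u) - 1 - Ci * u)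
                        + (Cexp (- (Ci * u)) - 1 - - (Ci * u))))%C
    by field.
  rewrite Cmod_mult, Cmod_inv, Cmod_R, (Rabs_pos_eq 2) by
    first [lra | apply RtoC_neq; lra].
  assert (T := Cmod_triangle (Cexp (Ci * u) - 1 - Ci * u)
                             (Cexp (- (Ci * u)) - 1 - - (Ci * u))).
  lra.
Qed.

Lemma Cinv_0 : (/ 0)%C = 0.
Proof. apply injective_projections; simpl; unfold Rdiv; ring. Qed.

(** [s cot s] tends to 1 as [s] tends to 0, applied to [s = e n * v]. *)
Lemma is_lim_scaled_Ccot (e : nat -> R) (v : C) : v <> 0 ->
  (forall n, 0 < e n) -> is_lim_seq e 0 ->
  is_lim_Cseq (fun n => e n * Ccot (e n * v))%C (/ v)%C.
Proof.
  intros Hv He Hlim.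
  assert (Hmod : forall n, Cmod (e n * v) = e n * Cmod v).
  { intros n. rewrite Cmod_mult, Cmod_R, Rabs_pos_eq; [ring|].
    apply Rlt_le, He. }
  assert (Hvp := proj1 (Cmod_gt_0 v) Hv).
  assert (Hsmall : eventually (fun n => Cmod (e n * v) <= / 2)).
  { apply is_lim_seq_spec in Hlim.
    destruct (Hlim (mkposreal (/ (2 * Cmod v)) ltac:(apply Rinv_0_lt_compat; lra)))
      as [N HN]. exists N. intros n Hn. specialize (HN n Hn). simpl in HN.
    rewrite Rminus_0_r in HN. apply Rabs_def2 in HN. rewrite Hmod.
    replace (/ 2) with (/ (2 * Cmod v) * Cmod v) by (field; lra).
    apply Rmult_le_compat_r; lra. }
  destruct Hsmall as [N HN].
  assert (HC : is_lim_Cseq (fun n => Ccos (e n * v)) 1).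
  { apply is_lim_Cseq_le with (fun n => 4 * Cmod v ^ 2 * (e n * e n)).
    - exists N. intros n Hn. eapply Rle_trans; [apply Ccos_taylor_1; auto|].
      rewrite Hmod. right. ring.
    - replace 0 with (4 * Cmod v ^ 2 * (0 * 0)) by ring.
      apply is_lim_seq_mult'; [apply is_lim_seq_const|].
      now apply is_lim_seq_mult'. }
  assert (HS : is_lim_Cseq (fun n => / e n * Csin (e n * v))%C v).
  { apply is_lim_Cseq_le with (fun n => 4 * Cmod v ^ 2 * e n).
    - exists N. intros n Hn. specialize (He n).
      assert (Hne : RtoC (e n) <> 0) by (apply RtoC_neq; lra).
      replace (/ e n * Csin (e n * v) - v)%C
        with (/ e n * (Csin (e n * v) - e n * v))%C by (field; exact Hne).
      rewrite Cmod_mult, Cmod_inv, Cmod_R, Rabs_pos_eq by (trivial; lra).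
      apply Rmult_le_reg_l with (e n); [exact He|].
      rewrite <- Rmult_assoc, Rinv_r, Rmult_1_l by lra.
      eapply Rle_trans; [apply Csin_taylor_1; auto|].
      rewrite Hmod. right. ring.
    - replace 0 with (4 * Cmod v ^ 2 * 0) by ring.
      apply is_lim_seq_mult'; [apply is_lim_seq_const|trivial]. }
  assert (H := is_lim_Cseq_mult _ _ _ _ HC (is_lim_Cseq_inv _ _ Hv HS)).
  rewrite Cmult_1_l in H.
  apply is_lim_Cseq_ext with (2 := H). intros n. unfold Ccot, Cdiv.
  assert (Hne : RtoC (e n) <> 0) by (specialize (He n); apply RtoC_neq; lra).
  destruct (Req_dec (Cmod (Csin (e n * v))) 0) as [E|E].
  - apply Cmod_eq_0 in E. rewrite E, Cmult_0_r, Cinv_0. ring.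
  - field. split; trivial. intros E'. apply E. now rewrite E', Cmod_0.
Qed.

(** A Jordan inequality slightly beyond [pi / 2], obtained at the half angle,
    where the cosine is still at least 1/2. *)
Lemma sin_ge_third (s : R) : 0 <= s <= 5 * PI / 8 -> s / 3 <= sin s.
Proof.
  intros Hs. assert (HPI := PI_4). assert (HPI0 := PI_RGT_0).
  set (h := s / 2). replace s with (2 * h) by (unfold h; field).
  assert (Hh : 0 <= h <= 5 / 4) by (unfold h; lra).
  rewrite sin_2a.
  assert (Hc : / 2 <= cos h).
  { replace (/ 2) with (cos (PI / 3)) by (rewrite cos_PI3; lra).
    apply cos_decr_1; unfold h; lra. }
  assert (Hsin := proj1 (pre_sin_bound h 0 ltac:(lra) ltac:(lra))).
  unfold sin_approx, sin_term in Hsin. simpl in Hsin.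
  assert (Hh3 : h - h * (h * h) / 6 <= sin h) by lra.
  assert (2 / 3 * h <= h - h * (h * h) / 6) by nra.
  nra.
Qed.

(** In [Ccot_multiple] at [t = pi z / N], multiplied by [pi / N], the [n]-th pair
    tends to [1 / (z + n) + 1 / (z - n)]. By [Ccot_add_sub] it is dominated: its
    numerator [sin (2 pi z / N)] is [O (|z| / N)], and the two sines below are at
    least of order [n / N], because [n <= N / 2] keeps their real arguments
    within [5 pi / 8] of 0. The summand [1 / z] on the right comes from the
    doubled index [n = 0]. *)
Theorem Ccot_partial_fractions (z : C) : Im z <> 0 ->
  is_lim_Cseq (sum_n (fun n => / (z + INR n) + / (z - INR n))%C)
              (PI * Ccot (PI * z) + / z)%C.
Proof.
  intros Hz. assert (HPI := PI_RGT_0).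
  set (e := fun m => PI / INR (2 * m + 1)).
  assert (HN : forall m, 1 <= INR (2 * m + 1))
    by (intros m; rewrite <- INR_1; apply le_INR; lia).
  assert (He : forall m, 0 < e m).
  { intros m. specialize (HN m). apply Rdiv_lt_0_compat; lra. }
  assert (Helim : is_lim_seq e 0).
  { assert (H : is_lim_seq (fun n => PI * / INR n) (PI * 0)).
    { apply is_lim_seq_mult'; [apply is_lim_seq_const|].
      apply (is_lim_seq_inv _ p_infty is_lim_seq_INR). easy. }
    rewrite Rmult_0_r in H.
    apply (is_lim_seq_subseq _ _ (fun m => (2 * m + 1)%nat)) in H;
      [exact H|].
    apply eventually_subseq. intros; lia. }
  set (pair := fun m n => (e m * Ccot (e m * (z + INR n))
                           + e m * Ccot (e m * (z - INR n)))%C).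
  (* Extending the finite sum by 0 turns it into a series over all [n]. *)
  set (f := fun m n => if le_dec n m then pair m n else RtoC 0).
  set (S := fun m => (PI * Ccot (PI * z) + e m * Ccot (e m * z))%C).
  assert (Hsum : forall m, (sum_n (pair m) m : C) = S m).
  { intros m. unfold S.
    assert (HNC : RtoC (INR (2 * m + 1)) <> 0)
      by (specialize (HN m); apply RtoC_neq; lra).
    assert (HIm : Im (e m * z) <> 0).
    { replace (Im (e m * z)) with (e m * Im z) by (unfold Im; simpl; ring).
      apply Rmult_integral_contrapositive. split; [|exact Hz].
      specialize (He m). lra. }
    assert (H := Ccot_multiple m _ HIm).
    assert (Ee : RtoC (e m) = (PI / INR (2 * m + 1))%C)
      by (unfold e; apply RtoC_div; specialize (HN m); lra).
    transitivity (e m * sum_n (fun i =>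
      Ccot (e m * z + PI * INR i / INR (2 * m + 1))
      + Ccot (e m * z - PI * INR i / INR (2 * m + 1))) m)%C.
    - rewrite <- sum_n_mult_l_C. apply sum_n_ext_C. intros i _. unfold pair.
      rewrite Ee.
      replace (PI / INR (2 * m + 1) * (z + INR i))%C
        with (PI / INR (2 * m + 1) * z + PI * INR i / INR (2 * m + 1))%C
        by (field; exact HNC).
      replace (PI / INR (2 * m + 1) * (z - INR i))%C
        with (PI / INR (2 * m + 1) * z - PI * INR i / INR (2 * m + 1))%C
        by (field; exact HNC).
      ring.
    - rewrite <- H. rewrite Ee at 1.
      replace (INR (2 * m + 1) * (e m * z))%C with (PI * z)%C
        by (rewrite Ee; field; exact HNC).
      rewrite Ee. field. exact HNC. }
  (* For [n >= 4 |z|] the numbers [n + Re z] and [n - Re z] lie between [3 n / 4]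
     and [5 n / 4]; multiplied by [pi / N] with [n <= N / 2], they stay below
     [5 pi / 8], as [sin_ge_third] requires. *)
  destruct (nfloor_ex (4 * Cmod z) ltac:(assert (H := Cmod_ge_0 z); lra))
    as [n0 [_ Hn0]].
  assert (Hk0 : eventually (fun m => e m * Cmod z <= / 4)).
  { assert (H := is_lim_seq_mult' _ _ _ _ Helim (is_lim_seq_const (Cmod z))).
    rewrite Rmult_0_l in H. apply is_lim_seq_spec in H.
    destruct (H (mkposreal (/ 4) ltac:(lra))) as [N HN']. exists N. intros n Hn.
    specialize (HN' n Hn). simpl in HN'. rewrite Rminus_0_r in HN'.
    apply Rabs_def2 in HN'. lra. }
  destruct Hk0 as [k0 Hk0].
  destruct (dominated_convergence_sum f
    (fun n => / (z + INR n) + / (z - INR n))%C S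
    (* With [e = pi / N], [96 |z| / n ^ 2] is [e * 6 e |z| / (e n / 4) ^ 2]. *)
    (fun n => 96 * Cmod z / INR n ^ 2) (Datatypes.S n0) k0) as [s [Hs HS]].
  - intros m i Hm Hi. unfold f. destruct (le_dec i m) as [Him|Him].
    2:{ rewrite Cmod_0. apply Rdiv_le_0_compat.
        - assert (H := Cmod_ge_0 z). lra.
        - apply pow_lt, lt_0_INR. lia. }
    specialize (Hk0 m Hm). specialize (He m).
    apply le_INR in Hi. rewrite S_INR in Hi.
    apply le_INR in Him.
    assert (Hem : e m * INR i <= PI / 2).
    { unfold e. assert (E : INR (2 * m + 1) = 2 * INR m + 1)
        by (rewrite plus_INR, mult_INR; simpl; ring).
      apply Rmult_le_reg_r with (INR (2 * m + 1)); [specialize (HN m); lra|].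
      replace (PI / INR (2 * m + 1) * INR i * INR (2 * m + 1))
        with (PI * INR i) by (field; specialize (HN m); lra).
      rewrite E. nra. }
    assert (Hzr := re_le_Cmod z). apply Rabs_le_between in Hzr.
    assert (Hsin : forall t, 3 / 4 * INR i <= t <= 5 / 4 * INR i ->
                     e m * INR i / 4 <= sin (e m * t)).
    { intros t Ht.
      apply Rle_trans with (e m * t / 3); [nra|].
      apply sin_ge_third. split; nra. }
    assert (Hpos : 0 < e m * INR i / 4).
    { assert (H := Cmod_ge_0 z). nra. }
    assert (H1 : e m * INR i / 4 <= Cmod (Csin (e m * z + e m * INR i))).
    { eapply Rle_trans; [|apply Csin_ge_sin].
      eapply Rle_trans; [|apply Rle_abs].
      replace (Re (e m * z + e m * INR i)) with (e m * (Re z + INR i))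
        by (unfold Re; simpl; ring).
      apply Hsin. lra. }
    assert (H2 : e m * INR i / 4 <= Cmod (Csin (e m * z - e m * INR i))).
    { eapply Rle_trans; [|apply Csin_ge_sin].
      replace (Re (e m * z - e m * INR i)) with (- (e m * (INR i - Re z)))
        by (unfold Re; simpl; ring).
      rewrite sin_neg, Rabs_Ropp.
      eapply Rle_trans; [|apply Rle_abs].
      apply Hsin. lra. }
    unfold pair.
    replace (e m * (z + INR i))%C with (e m * z + e m * INR i)%C by ring.
    replace (e m * (z - INR i))%C with (e m * z - e m * INR i)%C by ring.
    assert (N1 : Csin (e m * z + e m * INR i) <> 0) by (apply Cmod_gt_0; lra).
    assert (N2 : Csin (e m * z - e m * INR i) <> 0) by (apply Cmod_gt_0; lra).
    rewrite <- Cmult_plus_distr_l, Ccot_add_sub by trivial.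
    rewrite Cmod_mult, Cmod_div, Cmod_mult, Cmod_R, (Rabs_pos_eq (e m))
      by first [lra | now apply Cmult_neq_0].
    assert (H3 : Cmod (Csin (2 * (e m * z))) <= 6 * e m * Cmod z).
    { assert (E : Cmod (2 * (e m * z)) = 2 * (e m * Cmod z))
        by (rewrite !Cmod_mult, !Cmod_R, !Rabs_pos_eq by lra; ring).
      assert (T := Csin_taylor_1 (2 * (e m * z)) ltac:(rewrite E; lra)).
      assert (T' := Cmod_triangle_inv (Csin (2 * (e m * z))) (2 * (e m * z))).
      rewrite E in *. assert (0 <= e m * Cmod z)
        by (apply Rmult_le_pos; [lra|apply Cmod_ge_0]).
      nra. }
    set (A := Cmod (Csin (e m * z + e m * INR i))) in *.
    set (B := Cmod (Csin (e m * z - e m * INR i))) in *.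
    set (D := e m * INR i / 4) in *.
    apply Rle_trans with (e m * (6 * e m * Cmod z / (D * D))).
    + apply Rmult_le_compat_l; [lra|]. unfold Rdiv.
      apply Rmult_le_compat; trivial; try apply Cmod_ge_0.
      * apply Rlt_le, Rinv_0_lt_compat. nra.
      * apply Rinv_le_contravar; nra.
    + right. unfold D. field. split; [nra|lra].
  - apply ex_series_scal_inv_sqr.
  - intros n. apply is_lim_Cseq_ext_loc with (fun m => pair m n).
    + exists n. intros m Hm. unfold f. destruct (le_dec n m); [easy|lia].
    + apply is_lim_Cseq_plus; apply is_lim_scaled_Ccot; trivial;
        intros E; apply Hz; apply (f_equal Im) in E;
        unfold Im in *; simpl in E; lra.
  - intros m _. apply is_lim_Cseq_ext_loc with (fun _ => S m);
      [|apply is_lim_Cseq_const].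
    exists m. intros n Hn. rewrite <- Hsum. symmetry.
    induction Hn as [|n Hn IH].
    + apply sum_n_ext_C. intros i Hi. unfold f.
      destruct (le_dec i m); [easy|lia].
    + rewrite sum_Sn_C, IH. unfold f. destruct (le_dec (Datatypes.S n) m); [lia|].
      ring.
  - replace (PI * Ccot (PI * z) + / z)%C with s; trivial.
    apply (is_lim_Cseq_unique _ _ _ HS). unfold S.
    apply is_lim_Cseq_plus; [apply is_lim_Cseq_const|].
    apply is_lim_scaled_Ccot; trivial.
    intros E. apply Hz. now rewrite E.
Qed.

Lemma exp_le_compat (x y : R) : x <= y -> exp x <= exp y.
Proof.
  intros [H| ->]; [left; now apply exp_increasing | apply Rle_refl].
Qed.

(** * Infinite products *)

Fixpoint Cprod (E : nat -> C) (n : nat) : C :=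
  match n with
  | O => E O
  | S m => (Cprod E m * E (S m))%C
  end.

Lemma Cprod_S (E : nat -> C) (n : nat) :
  Cprod E (S n) = (Cprod E n * E (S n))%C.
Proof. reflexivity. Qed.

Lemma Cprod_minus_1 (E : nat -> C) (n : nat) :
  Cmod (Cprod E n - 1) <= exp (sum_n (fun j => Cmod (E j - 1)) n) - 1.
Proof.
  induction n as [|n IH].
  - rewrite sum_O. simpl. assert (H := exp_ineq1_le (Cmod (E O - 1))). lra.
  - rewrite sum_Sn_R, exp_plus. simpl Cprod.
    set (s := exp (sum_n (fun j => Cmod (E j - 1)) n)) in *.
    set (a := Cmod (E (S n) - 1)).
    replace (Cprod E n * E (S n) - 1)%C
      with ((Cprod E n - 1) * (E (S n) - 1) + (Cprod E n - 1) + (E (S n) - 1))%C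
      by ring.
    eapply Rle_trans; [apply Cmod_triangle|].
    eapply Rle_trans; [apply Rplus_le_compat_r, Cmod_triangle|].
    rewrite Cmod_mult. fold a.
    assert (H := exp_ineq1_le a).
    assert (Ha : 0 <= a) by apply Cmod_ge_0.
    assert (Hp := Cmod_ge_0 (Cprod E n - 1)). nra.
Qed.

Lemma Cprod_tail (E : nat -> C) (M : nat -> R) (n0 n m : nat) :
  (forall j, (n0 <= j)%nat -> Cmod (E j - 1) <= M j) -> (n0 <= n <= m)%nat ->
  Cmod (Cprod E m - Cprod E n)
  <= Cmod (Cprod E n) * (exp (sum_n M m - sum_n M n) - 1).
Proof.
  intros HE [Hn Hm]. induction Hm as [|m Hm IH].
  - rewrite Rminus_diag, exp_0.
    replace (Cprod E n - Cprod E n)%C with (RtoC 0) by ring. rewrite Cmod_0. lra.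
  - rewrite sum_Sn_R. simpl Cprod.
    replace (sum_n M m + M (S m) - sum_n M n)
      with (sum_n M m - sum_n M n + M (S m)) by ring.
    rewrite exp_plus. set (s := exp (sum_n M m - sum_n M n)) in *.
    replace (Cprod E m * E (S m) - Cprod E n)%C
      with ((Cprod E m - Cprod E n) * (E (S m) - 1)
            + (Cprod E m - Cprod E n) + Cprod E n * (E (S m) - 1))%C by ring.
    eapply Rle_trans; [apply Cmod_triangle|].
    eapply Rle_trans; [apply Rplus_le_compat_r, Cmod_triangle|].
    rewrite !Cmod_mult.
    specialize (HE (S m) ltac:(lia)).
    set (a := Cmod (E (S m) - 1)) in *. set (p := Cmod (Cprod E n)) in *.
    assert (H := exp_ineq1_le (M (S m))).
    assert (Ha : 0 <= a) by apply Cmod_ge_0.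
    assert (Hp : 0 <= p) by apply Cmod_ge_0.
    assert (Hs : 0 < s) by apply exp_pos.
    set (d := Cmod (Cprod E m - Cprod E n)) in *.
    assert (Hd : 0 <= d) by apply Cmod_ge_0.
    apply Rle_trans with (p * (s * (1 + a) - 1)).
    + assert (d * a <= p * (s - 1) * a) by (apply Rmult_le_compat_r; trivial).
      nra.
    + apply Rmult_le_compat_l; trivial. apply Rplus_le_compat_r.
      apply Rmult_le_compat_l; lra.
Qed.

(** Absolute convergence of [sum (E j - 1)]. For the limit not to vanish,
    it suffices to start at an index after which the product moves by at most
    half of its modulus. *)
Theorem Cprod_converges (E : nat -> C) (M : nat -> R) (n0 : nat) :
  (forall j, (n0 <= j)%nat -> Cmod (E j - 1) <= M j) -> ex_series M ->
  (forall j, E j <> 0) ->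
  exists l : C, l <> 0 /\ is_lim_Cseq (Cprod E) l.
Proof.
  intros HE HM Hne.
  set (t := fun n => exp (Series M - sum_n M n) - 1).
  assert (Ht : is_lim_seq t 0).
  { replace (Finite 0) with (Finite (exp 0 - 1)) by (rewrite exp_0; f_equal; ring).
    apply is_lim_seq_minus'; [|apply is_lim_seq_const].
    apply (is_lim_seq_continuous exp (fun n => Series M - sum_n M n) 0).
    - apply derivable_continuous_pt, derivable_pt_exp.
    - now apply is_lim_seq_tail. }
  assert (Hsum : forall n m, (n0 <= n <= m)%nat -> sum_n M m <= Series M).
  { intros n m Hnm.
    refine (is_lim_seq_le_loc (fun _ => sum_n M m) (sum_n M) (sum_n M m) (Series M)
              _ (is_lim_seq_const _) (Series_correct M HM)).
    exists m. intros p Hp.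
    assert (H := dominated_tail (fun j => E j - 1)%C M n0 m p HE ltac:(lia)).
    assert (H' := Cmod_ge_0 (sum_n (fun j => E j - 1)%C p
                              - sum_n (fun j => E j - 1)%C m)). lra. }
  assert (Htail : forall n m, (n0 <= n <= m)%nat ->
    Cmod (Cprod E m - Cprod E n) <= Cmod (Cprod E n) * t n).
  { intros n m Hnm. eapply Rle_trans; [exact (Cprod_tail E M n0 n m HE Hnm)|].
    apply Rmult_le_compat_l; [apply Cmod_ge_0|]. unfold t.
    apply Rplus_le_compat_r. apply exp_le_compat. specialize (Hsum n m Hnm). lra. }
  assert (Hnz : forall n, Cprod E n <> 0).
  { induction n as [|n IH]; simpl; [apply Hne|].
    apply Cmult_neq_0; trivial. }
  set (B := Cmod (Cprod E n0) * (1 + t n0)).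
  assert (HB : forall m, (n0 <= m)%nat -> Cmod (Cprod E m) <= B).
  { intros m Hm. assert (H := Htail n0 m ltac:(lia)).
    assert (H' := Cmod_triangle_inv (Cprod E m) (Cprod E n0)).
    unfold B. lra. }
  assert (Htpos : forall n, (n0 <= n)%nat -> 0 <= t n).
  { intros n Hn. assert (H := exp_ineq1_le (Series M - sum_n M n)).
    specialize (Hsum n n ltac:(lia)). unfold t. lra. }
  destruct (Cauchy_is_lim_Cseq (Cprod E) (fun n => B * t n)) as [l Hl].
  - replace 0 with (B * 0) by ring.
    apply is_lim_seq_mult'; [apply is_lim_seq_const|trivial].
  - exists n0. intros n Hn m Hm. eapply Rle_trans; [apply Htail; lia|].
    apply Rmult_le_compat_r; auto.
  - exists l. split; trivial.
    apply is_lim_seq_spec in Ht.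
    (* From [n] on the product stays within half its modulus of [Cprod E n]. *)
    destruct (Ht (mkposreal (/ 2) ltac:(lra))) as [n1 Hn1]. simpl in Hn1.
    set (n := max n0 n1). specialize (Hn1 n ltac:(lia)).
    rewrite Rminus_0_r in Hn1. apply Rabs_def2 in Hn1.
    assert (Hp := proj1 (Cmod_gt_0 _) (Hnz n)).
    apply Cmod_gt_0. apply Rlt_le_trans with (Cmod (Cprod E n) / 2); [lra|].
    refine (is_lim_seq_le_loc (fun _ => Cmod (Cprod E n) / 2)
              (fun m => Cmod (Cprod E m)) (Cmod (Cprod E n) / 2) (Cmod l)
              _ (is_lim_seq_const _) (is_lim_Cseq_Cmod _ _ Hl)).
    exists n. intros m Hm. assert (H := Htail n m ltac:(lia)).
    rewrite Cmod_minus_sym in H.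
    assert (H' := Cmod_triangle_inv (Cprod E n) (Cprod E m)).
    assert (Cmod (Cprod E n) * t n <= Cmod (Cprod E n) * / 2)
      by (apply Rmult_le_compat_l; lra).
    lra.
Qed.

(** * The Gamma function *)

(** Comparing with [1 / (1 + u)], the factor of Gauss's product, the exponential
    removes the first-order term, which makes products of such factors
    absolutely convergent. *)
Definition euler_factor (u : C) : C := (Cexp u / (1 + u))%C.

Lemma Cmod_1_plus (u : C) : Cmod u <= / 2 -> / 2 <= Cmod (1 + u).
Proof.
  intros Hu. assert (H := Cmod_triangle_inv 1 (- u)).
  rewrite Cmod_1, Cmod_opp in H. replace (1 - - u)%C with (1 + u)%C in H by ring.
  lra.
Qed.

Lemma euler_factor_estimate (u : C) : Cmod u <= / 2 ->
  Cmod (euler_factor u - 1) <= 8 * Cmod u ^ 2.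
Proof.
  intros Hu. assert (H := Cmod_1_plus u Hu).
  assert (Hne : (1 + u)%C <> 0) by (apply Cmod_gt_0; lra).
  unfold euler_factor.
  replace (Cexp u / (1 + u) - 1)%C with ((Cexp u - 1 - u) / (1 + u))%C
    by (field; exact Hne).
  rewrite Cmod_div by exact Hne.
  apply Rle_div_l; [lra|].
  assert (T := Cexp_taylor_1 u Hu). assert (S := pow2_ge_0 (Cmod u)). nra.
Qed.

Lemma ln_le_minus_1 (x : R) : 0 < x -> ln x <= x - 1.
Proof.
  intros Hx. assert (H := exp_ineq1_le (ln x)). rewrite exp_ln in H by trivial. lra.
Qed.

(** The limit is the opposite of Euler's constant. *)
Lemma harmonic_minus_ln_converges :
  exists g : R, is_lim_seq
    (fun n => ln (INR (S n)) - sum_n (fun j => / INR (S j)) n) g.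
Proof.
  assert (Hpos : forall n, 0 < INR (S n)) by (intros; apply lt_0_INR; lia).
  assert (Hln : forall n, ln (INR (S (S n))) - ln (INR (S n)) <= / INR (S n)
                /\ / INR (S (S n)) <= ln (INR (S (S n))) - ln (INR (S n))).
  { intros n. assert (H1 := Hpos n). assert (H2 := Hpos (S n)).
    rewrite <- ln_div by trivial. rewrite (S_INR (S n)) in *. split.
    - eapply Rle_trans; [apply ln_le_minus_1, Rdiv_lt_0_compat; trivial|].
      right. field. lra.
    - assert (H := ln_le_minus_1 (INR (S n) / (INR (S n) + 1))
                     ltac:(now apply Rdiv_lt_0_compat)).
      rewrite ln_div in * by trivial.
      replace (/ (INR (S n) + 1)) with (1 - INR (S n) / (INR (S n) + 1))
        by (field; lra).
      lra. }
  assert (Hex : ex_finite_lim_seq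
    (fun n => ln (INR (S n)) - sum_n (fun j => / INR (S j)) n)).
  { apply ex_finite_lim_seq_incr with 0.
    - intros n. rewrite sum_Sn_R. destruct (Hln n). lra.
    - intros n. assert (ln (INR (S (S n))) <= sum_n (fun j => / INR (S j)) n).
      { induction n as [|n IH].
        - rewrite sum_O. destruct (Hln O) as [H _].
          rewrite INR_1, ln_1 in H at 1. rewrite INR_1 in *. lra.
        - rewrite sum_Sn_R. destruct (Hln (S n)). lra. }
      destruct (Hln n) as [_ H'].
      assert (0 < / INR (S (S n))) by apply Rinv_0_lt_compat, Hpos. lra. }
  exact Hex.
Qed.

Lemma rising_neq_0 (z : C) (n : nat) :
  (forall j, z + INR j <> 0)%C -> rising z n <> 0.
Proof.
  intros Hz. induction n as [|n IH].
  - simpl. specialize (Hz O). simpl in Hz. now rewrite Cplus_0_r in Hz.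
  - apply Cmult_neq_0; [exact IH | exact (Hz (S n))].
Qed.

Lemma RtoC_INR_S_neq_0 (n : nat) : RtoC (INR (S n)) <> 0.
Proof. apply RtoC_neq, not_0_INR. lia. Qed.

(** Weierstrass's form of Gauss's product. *)
Lemma CGamma_seq_weierstrass (z : C) (n : nat) :
  (forall j, z + INR j <> 0)%C ->
  CGamma_seq z (S n)
  = (/ z * Cexp (z * (ln (INR (S n)) - sum_n (fun j => / INR (S j)) n)%R)
     * Cprod (fun j => euler_factor (z / INR (S j))) n)%C.
Proof.
  intros Hz.
  assert (Hz0 : z <> 0) by (specialize (Hz O); simpl in Hz; now rewrite Cplus_0_r in Hz).
  assert (HP : (Cprod (fun j => euler_factor (z / INR (S j))) n
    = Cexp (z * sum_n (fun j => / INR (S j))%R n)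
      * (z * INR (fact (S n)) / rising z (S n)))%C).
  { induction n as [|n IH].
    - specialize (Hz 1%nat). rewrite sum_O. simpl Cprod. simpl rising.
      simpl fact. unfold euler_factor. rewrite INR_1 in *.
      rewrite Rinv_1, Cmult_1_r. replace (z / 1)%C with z by field.
      field. now split.
    - rewrite sum_Sn_R, Cprod_S, IH. unfold euler_factor.
      assert (HS := RtoC_INR_S_neq_0 (S n)).
      rewrite RtoC_plus, Cmult_plus_distr_l, Cexp_add.
      rewrite (RtoC_inv (INR (S (S n)))) by (apply not_0_INR; lia).
      fold (Cdiv z (INR (S (S n)))).
      change (rising z (S (S n))) with (rising z (S n) * (z + INR (S (S n))))%C.
      change (fact (S (S n))) with (S (S n) * fact (S n))%nat.
      rewrite mult_INR, RtoC_mult.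
      assert (HR := rising_neq_0 z (S n) Hz). specialize (Hz (S (S n))).
      field. repeat split; trivial. }
  rewrite HP. unfold CGamma_seq.
  set (H := sum_n (fun j => / INR (S j))%R n).
  rewrite RtoC_minus.
  replace (z * (ln (INR (S n)) - H))%C with (z * ln (INR (S n)) + - (z * H))%C by ring.
  rewrite Cexp_add, Cexp_opp.
  assert (HR := rising_neq_0 z (S n) Hz).
  field. repeat split; trivial. apply Cexp_neq_0.
Qed.

Lemma Cmod_Cexp_minus_1 (u : C) : Cmod u <= / 2 ->
  Cmod (Cexp u - 1) <= 3 * Cmod u.
Proof.
  intros Hu. assert (H := Cexp_taylor_1 u Hu).
  assert (H' := Cmod_triangle_inv (Cexp u - 1) u).
  assert (H0 := Cmod_ge_0 u). nra.
Qed.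

Lemma is_lim_Cexp (u : nat -> C) (l : C) :
  is_lim_Cseq u l -> is_lim_Cseq (fun n => Cexp (u n)) (Cexp l).
Proof.
  intros Hu.
  apply is_lim_Cseq_le with (fun n => Cmod (Cexp l) * (3 * Cmod (u n - l))).
  - assert (Hu' := Hu). apply is_lim_seq_spec in Hu'.
    destruct (Hu' (mkposreal (/ 2) ltac:(lra))) as [N HN]. simpl in HN.
    exists N. intros n Hn. specialize (HN n Hn).
    rewrite Rminus_0_r in HN. apply Rabs_def2 in HN.
    replace (Cexp (u n)) with (Cexp l * Cexp (u n - l))%C
      by (rewrite <- Cexp_add; f_equal; ring).
    replace (Cexp l * Cexp (u n - l) - Cexp l)%C
      with (Cexp l * (Cexp (u n - l) - 1))%C by ring.
    rewrite Cmod_mult. apply Rmult_le_compat_l; [apply Cmod_ge_0|].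
    apply Cmod_Cexp_minus_1. lra.
  - replace 0 with (Cmod (Cexp l) * (3 * 0)) by ring.
    apply is_lim_seq_mult'; [apply is_lim_seq_const|].
    now apply is_lim_seq_mult'; [apply is_lim_seq_const|].
Qed.

Definition not_pole (z : C) : Prop := forall j : nat, (z + INR j)%C <> 0.

Lemma not_pole_0 (z : C) : not_pole z -> z <> 0.
Proof. intros H E. apply (H O). rewrite E. simpl. ring. Qed.

Lemma Cmod_INR (n : nat) : Cmod (INR n) = INR n.
Proof. rewrite Cmod_R. apply Rabs_pos_eq, pos_INR. Qed.

(** Each of the three factors in [CGamma_seq_weierstrass] converges to a nonzero
    limit. *)
Theorem CGamma_correct (z : C) : not_pole z ->
  CGamma z <> 0 /\ is_lim_Cseq (CGamma_seq z) (CGamma z).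
Proof.
  intros Hz. assert (Hz0 := not_pole_0 z Hz).
  destruct (nfloor_ex (2 * Cmod z) ltac:(assert (H := Cmod_ge_0 z); lra))
    as [n0 [_ Hn0]].
  assert (HS : forall j, 0 < INR (S j)) by (intros; apply lt_0_INR; lia).
  assert (Hmod : forall j, Cmod (z / INR (S j)) = Cmod z / INR (S j)).
  { intros j. rewrite Cmod_div, Cmod_INR by apply RtoC_INR_S_neq_0. reflexivity. }
  destruct (Cprod_converges (fun j => euler_factor (z / INR (S j)))
    (fun j => 8 * Cmod z ^ 2 * / INR (S j) ^ 2) n0) as [p [Hp0 Hp]].
  - intros j Hj.
    replace (8 * Cmod z ^ 2 * / INR (S j) ^ 2)
      with (8 * (Cmod (z / INR (S j))) ^ 2)
      by (rewrite Hmod; field; specialize (HS j); lra).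
    apply euler_factor_estimate. rewrite Hmod.
    apply Rle_div_l; [apply HS|]. apply le_INR in Hj. rewrite S_INR. lra.
  - apply (ex_series_scal_l (8 * Cmod z ^ 2) _ ex_series_inv_sqr).
  - intros j E. unfold euler_factor in E.
    assert (H1 : (1 + z / INR (S j))%C <> 0).
    { intros E'. apply (Hz (S j)).
      transitivity (INR (S j) * (1 + z / INR (S j)))%C;
        [field; apply RtoC_INR_S_neq_0 | rewrite E'; ring]. }
    apply (Cexp_neq_0 (z / INR (S j))).
    transitivity ((1 + z / INR (S j)) * (Cexp (z / INR (S j)) / (1 + z / INR (S j))))%C;
      [field; split; [apply RtoC_INR_S_neq_0|]|rewrite E; ring].
    intros E'. apply (Hz (S j)). rewrite <- E'. ring.
  - destruct harmonic_minus_ln_converges as [g Hg].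
    assert (Hlim : is_lim_Cseq (CGamma_seq z) (/ z * Cexp (z * g) * p)%C).
    { apply is_lim_seq_incr_1.
      apply is_lim_Cseq_ext with (fun n => / z
        * Cexp (z * (ln (INR (S n)) - sum_n (fun j => / INR (S j)) n)%R)
        * Cprod (fun j => euler_factor (z / INR (S j))) n)%C.
      - intros n. symmetry. now apply CGamma_seq_weierstrass.
      - apply is_lim_Cseq_mult; [|exact Hp].
        apply is_lim_Cseq_scal, is_lim_Cexp, is_lim_Cseq_scal.
        now apply is_lim_Cseq_RtoC. }
    assert (E : CGamma z = (/ z * Cexp (z * g) * p)%C).
    { unfold CGamma.
      rewrite (is_lim_seq_unique _ _ (is_lim_Cseq_Re _ _ Hlim)).
      rewrite (is_lim_seq_unique _ _ (is_lim_Cseq_Im _ _ Hlim)).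
      symmetry. apply surjective_pairing. }
    rewrite E. split; trivial.
    apply Cmult_neq_0; [|exact Hp0].
    apply Cmult_neq_0; [|apply Cexp_neq_0].
    intros E'. apply C1_nz. rewrite <- (Cinv_l z Hz0), E'. ring.
Qed.

(** * The digamma function *)

(** The logarithmic derivative of [z |-> CGamma_seq z n]. *)
Definition log_deriv_seq (z : C) (n : nat) : C :=
  (ln (INR n) - sum_n (fun j => / (z + INR j))%C n)%C.

Lemma Cmod_inv_add_INR (z : C) (j : nat) :
  2 * Cmod z <= INR j -> 0 < INR j -> Cmod (/ (z + INR j)) <= 2 / INR j.
Proof.
  intros Hj Hpos.
  assert (H := Cmod_triangle_inv (INR j) (- z)).
  replace (INR j - - z)%C with (z + INR j)%C in H by ring.
  rewrite Cmod_opp, Cmod_INR in H.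
  assert (Hge : INR j / 2 <= Cmod (z + INR j)) by lra.
  rewrite Cmod_inv by (apply Cmod_gt_0; lra).
  replace (2 / INR j) with (/ (INR j / 2)) by (field; lra).
  apply Rinv_le_contravar; lra.
Qed.

Lemma log_deriv_seq_converges (z : C) : not_pole z ->
  exists psi : C, is_lim_Cseq (log_deriv_seq z) psi.
Proof.
  intros Hz. destruct harmonic_minus_ln_converges as [g Hg].
  destruct (nfloor_ex (2 * Cmod z) ltac:(assert (H := Cmod_ge_0 z); lra))
    as [n0 [_ Hn0]].
  set (a := fun j => (/ INR (S j) - / (z + INR (S j)))%C).
  destruct (dominated_ex_lim a (fun j => 2 * Cmod z * / INR (S j) ^ 2) n0)
    as [s Hs].
  - intros j Hj. assert (HS : 0 < INR (S j)) by (apply lt_0_INR; lia).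
    assert (HSC := RtoC_INR_S_neq_0 j). specialize (Hz (S j)).
    unfold a. replace (/ INR (S j) - / (z + INR (S j)))%C
      with (z * / INR (S j) * / (z + INR (S j)))%C by (field; now split).
    rewrite !Cmod_mult, (Cmod_inv (INR (S j))), Cmod_INR by trivial.
    replace (2 * Cmod z * / INR (S j) ^ 2)
      with (Cmod z * / INR (S j) * (2 / INR (S j))) by (field; lra).
    apply Rmult_le_compat_l.
    + apply Rmult_le_pos; [apply Cmod_ge_0|]. left. now apply Rinv_0_lt_compat.
    + apply Cmod_inv_add_INR; trivial. apply le_INR in Hj. rewrite S_INR. lra.
  - apply (ex_series_scal_l (2 * Cmod z) _ ex_series_inv_sqr).
  - exists (g - / z + s)%C. apply is_lim_seq_incr_1.
    apply is_lim_Cseq_ext with (fun n =>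
      (ln (INR (S n)) - sum_n (fun j => / INR (S j)) n)%R - / z + sum_n a n)%C.
    + intros n. unfold log_deriv_seq. rewrite sum_n_shift_C.
      rewrite RtoC_minus, <- sum_n_RtoC.
      assert (E : (sum_n a n : C) = (sum_n (fun j => RtoC (/ INR (S j))) n
                    - sum_n (fun j => / (z + INR (S j))) n)%C).
      { induction n as [|n IH].
        - rewrite !sum_O. unfold a. now rewrite RtoC_inv by (apply not_0_INR; lia).
        - rewrite !sum_Sn_C, IH. unfold a.
          rewrite RtoC_inv by (apply not_0_INR; lia). ring. }
      rewrite E. replace (z + INR 0)%C with z by (simpl; ring). ring.
    + apply is_lim_Cseq_plus; trivial.
      apply is_lim_Cseq_minus; [|apply is_lim_Cseq_const].
      now apply is_lim_Cseq_RtoC.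
Qed.

(** Besides controlling the sum of the squares, the bound keeps every [z + j] at
    a distance of at least [1 / sqrt A] from 0. *)
Lemma inv_sqr_sum_bounded (z : C) : not_pole z ->
  exists A : R, 0 < A /\
    forall n, sum_n (fun j => Cmod (/ (z + INR j)) ^ 2) n <= A.
Proof.
  intros Hz.
  destruct (nfloor_ex (2 * Cmod z) ltac:(assert (H := Cmod_ge_0 z); lra))
    as [n0 [_ Hn0]].
  assert (Hex : ex_series (fun j => Cmod (/ (z + INR j)) ^ 2)).
  { apply (ex_series_incr_n _ (S n0)).
    apply (ex_series_le (K := R_AbsRing) (V := R_CompleteNormedModule) _
             (fun j => 4 / INR (S n0 + j) ^ 2)).
    - intros j. set (k := (S n0 + j)%nat).
      assert (Hk : INR (S n0) <= INR k) by (apply le_INR; lia).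
      rewrite S_INR in Hk. assert (H0 := pos_INR n0).
      assert (H := Cmod_inv_add_INR z k ltac:(lra) ltac:(lra)).
      assert (H' := Cmod_ge_0 (/ (z + INR k))).
      unfold norm; simpl norm; unfold abs; simpl abs.
      rewrite Rabs_pos_eq by apply pow2_ge_0.
      replace (4 / INR k ^ 2) with ((2 / INR k) ^ 2) by (field; lra).
      apply pow_incr. now split.
    - apply (ex_series_incr_n (fun j => 4 / INR j ^ 2)).
      apply ex_series_scal_inv_sqr. }
  assert (Hle : forall n, sum_n (fun j => Cmod (/ (z + INR j)) ^ 2) n
                          <= Series (fun j => Cmod (/ (z + INR j)) ^ 2)).
  { intros n.
    apply (is_lim_seq_incr_compare
             (sum_n (fun j => Cmod (/ (z + INR j)) ^ 2)) _
             (Series_correct _ Hex)).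
    intros m. rewrite sum_Sn_R. assert (H := pow2_ge_0 (Cmod (/ (z + INR (S m))))).
    lra. }
  exists (Series (fun j => Cmod (/ (z + INR j)) ^ 2) + 1). split.
  - specialize (Hle O). rewrite sum_O in Hle.
    assert (H := pow2_ge_0 (Cmod (/ (z + INR 0)))). lra.
  - intros n. specialize (Hle n). lra.
Qed.

(** Isolating the first-order part [exp (h L_n)] leaves factors that are
    [1 + O (h ^ 2)] with a summable constant. *)
Lemma CGamma_seq_ratio (z h : C) (n : nat) : not_pole z -> not_pole (z + h) ->
  CGamma_seq (z + h) n
  = (CGamma_seq z n * (Cexp (h * log_deriv_seq z n)
       * Cprod (fun j => euler_factor (h / (z + INR j))) n))%C.
Proof.
  intros Hz Hzh. unfold log_deriv_seq.
  assert (HP : (Cprod (fun j => euler_factor (h / (z + INR j))) n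
    = Cexp (h * sum_n (fun j => / (z + INR j))%C n)
      * (rising z n / rising (z + h) n))%C).
  { induction n as [|n IH].
    - assert (Hz0 := not_pole_0 z Hz). assert (Hzh0 := not_pole_0 _ Hzh).
      rewrite sum_O. simpl. unfold euler_factor, Cdiv. rewrite Cplus_0_r.
      field. now split.
    - rewrite sum_Sn_C, Cprod_S, IH. unfold euler_factor.
      rewrite Cmult_plus_distr_l, Cexp_add.
      fold (Cdiv h (z + INR (S n))).
      change (rising z (S n)) with (rising z n * (z + INR (S n)))%C.
      change (rising (z + h) (S n)) with (rising (z + h) n * (z + h + INR (S n)))%C.
      assert (HR := rising_neq_0 (z + h) n Hzh).
      specialize (Hz (S n)). specialize (Hzh (S n)).
      field. repeat split; trivial. }
  rewrite HP. unfold CGamma_seq.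
  set (H := sum_n (fun j => / (z + INR j))%C n).
  replace ((z + h) * ln (INR n))%C with (z * ln (INR n) + h * ln (INR n))%C by ring.
  replace (h * (ln (INR n) - H))%C with (h * ln (INR n) + - (h * H))%C by ring.
  rewrite !Cexp_add, Cexp_opp.
  assert (HR := rising_neq_0 z n Hz). assert (HR' := rising_neq_0 _ n Hzh).
  field. repeat split; trivial. apply Cexp_neq_0.
Qed.

Lemma le_sum_n_R (a : nat -> R) (j : nat) :
  (forall i, 0 <= a i) -> a j <= sum_n a j.
Proof.
  intros Ha. destruct j as [|j]; [rewrite sum_O; lra|].
  rewrite sum_Sn_R.
  assert (0 <= sum_n a j); [|lra].
  induction j as [|j IH]; [rewrite sum_O; apply Ha|].
  rewrite sum_Sn_R. specialize (Ha (S j)). lra.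
Qed.

(** The factorisation [CGamma_seq_ratio] gives a second-order error bound for
    Gauss's product that is uniform in [n], so it survives the limit and the
    derivative of Gamma is found without interchanging limits. *)
Lemma CGamma_taylor_1 (z : C) : not_pole z ->
  exists (psi : C) (K delta : R),
    is_lim_Cseq (log_deriv_seq z) psi /\ 0 <= K /\ 0 < delta /\
    forall h : C, Cmod h <= delta ->
      Cmod (CGamma (z + h) - CGamma z - CGamma z * (h * psi)) <= K * Cmod h ^ 2.
Proof.
  intros Hz.
  destruct (log_deriv_seq_converges z Hz) as [psi Hpsi].
  destruct (inv_sqr_sum_bounded z Hz) as [A [HA Hsum]].
  destruct (CGamma_correct z Hz) as [HG0 HG].
  set (B := Cmod psi + 1).
  assert (HB1 : 1 <= B) by (assert (H := Cmod_ge_0 psi); unfold B; lra).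
  assert (HB : eventually (fun n => Cmod (log_deriv_seq z n) <= B)).
  { assert (H := Hpsi). apply is_lim_seq_spec in H.
    destruct (H (mkposreal 1 ltac:(lra))) as [N HN]. exists N. intros n Hn.
    specialize (HN n Hn). simpl in HN. rewrite Rminus_0_r in HN.
    apply Rabs_def2 in HN.
    assert (T := Cmod_triangle_inv (log_deriv_seq z n) psi). unfold B. lra. }
  assert (HA4 : 0 < / (16 * (A + 1))) by (apply Rinv_0_lt_compat; lra).
  assert (HA16 : / (16 * (A + 1)) * (16 * (A + 1)) = 1) by (field; lra).
  (* For [|h| <= c < 1] the exponent [8 A h ^ 2] below is at most 1/2, and for
     [|h| <= d] so is [|h L_n|]; the Taylor bounds then apply. *)
  set (c := / (16 * (A + 1))) in *.
  assert (HB2 : 0 < / (2 * B)) by (apply Rinv_0_lt_compat; lra).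
  assert (HBB : / (2 * B) * (2 * B) = 1) by (field; lra).
  set (d := / (2 * B)) in *.
  assert (Hc1 : c < 1) by nra.
  exists psi, (Cmod (CGamma z) * (48 * A + 4 * B ^ 2)), (Rmin c d).
  split; [exact Hpsi|]. split.
  { apply Rmult_le_pos; [apply Cmod_ge_0|]. nra. }
  split; [now apply Rmin_glb_lt|].
  intros h Hh.
  assert (Hhc := Rle_trans _ _ _ Hh (Rmin_l c d)).
  assert (Hhd := Rle_trans _ _ _ Hh (Rmin_r c d)).
  assert (Hh0 := Cmod_ge_0 h).
  assert (Hh2 : 16 * A * Cmod h ^ 2 <= 1).
  { assert (Cmod h ^ 2 <= c) by nra. nra. }
  assert (Hsmall : forall j, Cmod (h / (z + INR j)) <= / 2).
  { intros j. unfold Cdiv. rewrite Cmod_mult.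
    assert (H := le_sum_n_R (fun j => Cmod (/ (z + INR j)) ^ 2) j
                   (fun i => pow2_ge_0 _)).
    specialize (Hsum j). cbv beta in H.
    assert (Hp := Cmod_ge_0 (/ (z + INR j))).
    set (x := Cmod (/ (z + INR j))) in *. set (y := Cmod h) in *.
    assert (x ^ 2 <= A) by lra.
    assert ((y * x) ^ 2 <= / 16).
    { replace ((y * x) ^ 2) with (y ^ 2 * x ^ 2) by ring.
      assert (0 <= y ^ 2) by apply pow2_ge_0. nra. }
    assert (0 <= y * x) by (apply Rmult_le_pos; trivial). nra. }
  assert (Hzh : not_pole (z + h)).
  { intros j E. assert (H := Cmod_1_plus _ (Hsmall j)). specialize (Hz j).
    replace (1 + h / (z + INR j))%C with ((z + h + INR j) / (z + INR j))%C in H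
      by (field; exact Hz).
    rewrite E in H. unfold Cdiv in H. rewrite Cmult_0_l, Cmod_0 in H. lra. }
  destruct (CGamma_correct (z + h) Hzh) as [_ HGh].
  set (R := fun n => (CGamma_seq (z + h) n - CGamma_seq z n
                      - CGamma_seq z n * (h * log_deriv_seq z n))%C).
  assert (HR : is_lim_Cseq R
    (CGamma (z + h) - CGamma z - CGamma z * (h * psi))%C).
  { apply is_lim_Cseq_minus; [now apply is_lim_Cseq_minus|].
    apply is_lim_Cseq_mult; trivial. now apply is_lim_Cseq_scal. }
  apply is_lim_Cseq_Cmod in HR.
  assert (Hbound := is_lim_seq_mult' _ _ _ _ (is_lim_Cseq_Cmod _ _ HG)
    (is_lim_seq_const ((48 * A + 4 * B ^ 2) * Cmod h ^ 2))).
  rewrite Rmult_assoc.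
  refine (is_lim_seq_le_loc _ _ (Cmod _) (_ * _) _ HR Hbound).
  destruct HB as [N HN]. exists N. intros n Hn. specialize (HN n Hn).
  unfold R. rewrite CGamma_seq_ratio by trivial.
  set (P := Cprod (fun j => euler_factor (h / (z + INR j))) n).
  set (L := log_deriv_seq z n) in *.
  replace (CGamma_seq z n * (Cexp (h * L) * P) - CGamma_seq z n
           - CGamma_seq z n * (h * L))%C
    with (CGamma_seq z n * ((Cexp (h * L) - 1) * (P - 1) + (P - 1)
                            + (Cexp (h * L) - 1 - h * L)))%C by ring.
  rewrite Cmod_mult. apply Rmult_le_compat_l; [apply Cmod_ge_0|].
  assert (HP : Cmod (P - 1) <= 16 * A * Cmod h ^ 2).
  { eapply Rle_trans; [apply Cprod_minus_1|].
    assert (Hs : sum_n (fun j => Cmod (euler_factor (h / (z + INR j)) - 1)) n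
                 <= 8 * A * Cmod h ^ 2).
    { apply Rle_trans with
        (sum_n (fun j => 8 * Cmod h ^ 2 * Cmod (/ (z + INR j)) ^ 2) n).
      - clear - Hsmall. induction n as [|n IH].
        + rewrite !sum_O. eapply Rle_trans; [apply euler_factor_estimate, Hsmall|].
          unfold Cdiv. rewrite Cmod_mult. right. ring.
        + rewrite !sum_Sn_R. apply Rplus_le_compat; trivial.
          eapply Rle_trans; [apply euler_factor_estimate, Hsmall|].
          unfold Cdiv. rewrite Cmod_mult. right. ring.
      - rewrite sum_n_mult_l_R.
        replace (8 * A * Cmod h ^ 2) with (8 * Cmod h ^ 2 * A) by ring.
        apply Rmult_le_compat_l; [nra|apply Hsum]. }
    set (s := sum_n _ n) in *.
    assert (Hs0 : 0 <= s).
    { unfold s. eapply Rle_trans; [apply Cmod_ge_0|apply Cmod_sum_n]. }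
    assert (H := exp_taylor_1 s ltac:(rewrite Rabs_pos_eq; lra)).
    apply Rabs_le_between in H. nra. }
  assert (HhL : Cmod (h * L) <= Cmod h * B)
    by (rewrite Cmod_mult; now apply Rmult_le_compat_l).
  assert (HhB : Cmod h * B <= / 2) by nra.
  assert (HhL0 := Cmod_ge_0 (h * L)).
  assert (HE := Cexp_taylor_1 (h * L) ltac:(lra)).
  assert (HE1 := Cmod_Cexp_minus_1 (h * L) ltac:(lra)).
  eapply Rle_trans; [apply Cmod_triangle|].
  eapply Rle_trans; [apply Rplus_le_compat_r, Cmod_triangle|].
  rewrite Cmod_mult.
  assert (HP0 := Cmod_ge_0 (P - 1)).
  assert (Cmod (h * L) ^ 2 <= B ^ 2 * Cmod h ^ 2) by nra.
  assert (Cmod (Cexp (h * L) - 1) * Cmod (P - 1) <= 2 * Cmod (P - 1))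
    by (apply Rmult_le_compat_r; lra).
  nra.
Qed.

Theorem Cdigamma_lim (z : C) : not_pole z ->
  is_lim_Cseq (log_deriv_seq z) (Cdigamma z).
Proof.
  intros Hz.
  destruct (CGamma_taylor_1 z Hz) as [psi [K [delta [Hpsi [HK [Hd Hest]]]]]].
  destruct (CGamma_correct z Hz) as [HG0 _].
  replace (Cdigamma z) with psi; trivial.
  unfold Cdigamma, C_derive.
  rewrite (is_C_lim_unique _ z (CGamma z * psi)%C); [field; exact HG0|].
  intros P [eps HP].
  assert (Hs2 : 0 < sqrt 2) by (apply sqrt_lt_R0; lra).
  set (r := Rmin delta (eps / (2 * (K + 1)))).
  assert (Heps := cond_pos eps).
  assert (Hr : 0 < r).
  { apply Rmin_glb_lt; trivial. apply Rdiv_lt_0_compat; lra. }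
  exists (mkposreal (r / sqrt 2) ltac:(now apply Rdiv_lt_0_compat)).
  intros y Hy Hne. apply HP, C_NormedModule_mixin_compat1.
  apply C_NormedModule_mixin_compat2 in Hy. simpl in Hy.
  replace (sqrt 2 * (r / sqrt 2)) with r in Hy by (field; lra).
  change (minus y z) with (y - z)%C in Hy.
  set (h := (y - z)%C) in *.
  assert (Eh : @eq C (z + h)%C y) by (unfold h; ring).
  assert (Hh : h <> 0).
  { intros E. apply Hne. rewrite <- Eh, E. apply Cplus_0_r. }
  assert (Hhp := proj1 (Cmod_gt_0 h) Hh).
  specialize (Hest h ltac:(apply Rlt_le, Rlt_le_trans with (1 := Hy), Rmin_l)).
  rewrite Eh in Hest.
  change (minus ((CGamma y - CGamma z) / h) (CGamma z * psi))%C
    with ((CGamma y - CGamma z) / h - CGamma z * psi)%C.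
  replace ((CGamma y - CGamma z) / h - CGamma z * psi)%C
    with ((CGamma y - CGamma z - CGamma z * (h * psi)) / h)%C by (field; exact Hh).
  rewrite Cmod_div by exact Hh.
  apply Rlt_div_l; [exact Hhp|].
  eapply Rle_lt_trans; [exact Hest|].
  assert (Hy2 : Cmod h < eps / (2 * (K + 1)))
    by (apply Rlt_le_trans with (1 := Hy), Rmin_r).
  apply Rlt_div_r in Hy2; [|lra]. nra.
Qed.

(** * Averages over the roots of -1 *)
Lemma root_system_ext (N : nat) (c : C) (zeta xi : nat -> C) :
  (forall r, zeta r = xi r) -> root_system N c zeta -> root_system N c xi.
Proof.
  intros E [H1 H2]. split.
  - intros r. now rewrite <- E.
  - intros p Hp. rewrite <- (H2 p Hp). apply sum_n_ext_C. intros r _. now rewrite E.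
Qed.

Lemma root_system_opp_1 (N : nat) (zeta : nat -> C) : (0 < N)%nat ->
  (forall r, zeta r = cis (PI / INR N + 2 * PI * INR r / INR N)) ->
  root_system N (- (1))%C zeta.
Proof.
  intros HN Hz. assert (HN' := lt_0_INR N HN).
  rewrite <- cis_PI. replace PI with (INR N * (PI / INR N)) by (field; lra).
  apply root_system_ext with (2 := root_system_cis N (PI / INR N) HN).
  intros r. now rewrite Hz.
Qed.

Lemma eps_cis (k r : nat) : (1 <= k)%nat ->
  eps k r = cis (PI / INR (2 * k) + 2 * PI * INR r / INR (2 * k)).
Proof.
  intros Hk. assert (H : 0 < INR k) by (apply lt_0_INR; lia).
  assert (HC : RtoC (INR k) <> 0) by (apply RtoC_neq; lra).
  unfold eps. rewrite <- Cexp_cis. f_equal.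
  rewrite mult_INR. simpl (INR 2).
  replace (PI / ((1 + 1) * INR k) + 2 * PI * INR r / ((1 + 1) * INR k))
    with (2 * PI * (INR r + / 2) * / (2 * INR k)) by (field; lra).
  rewrite !RtoC_mult, RtoC_plus, (RtoC_inv (2 * INR k)), RtoC_mult, (RtoC_inv 2) by lra.
  field. exact HC.
Qed.

Lemma eps_root_system (k : nat) : (1 <= k)%nat ->
  root_system (2 * k) (- (1))%C (eps k).
Proof.
  intros Hk. apply root_system_opp_1; [lia|]. intros r. now apply eps_cis.
Qed.

Lemma eps_sqr_root_system (k : nat) : (1 <= k)%nat ->
  root_system k (- (1))%C (fun r => eps k r ^ 2)%C.
Proof.
  intros Hk. assert (H : 0 < INR k) by (apply lt_0_INR; lia).
  apply root_system_opp_1; [lia|]. intros r.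
  rewrite eps_cis, cis_pow by trivial. f_equal. rewrite mult_INR. simpl (INR 2).
  field. lra.
Qed.

Lemma omega_root_system (k : nat) :
  root_system (2 * k + 1) (- (1))%C (omega k).
Proof.
  apply root_system_opp_1; [lia|]. intros r.
  assert (H := pos_INR k).
  assert (E : INR (2 * k + 1) = 2 * INR k + 1)
    by (rewrite plus_INR, mult_INR; simpl; ring).
  assert (HC : RtoC (2 * INR k + 1) <> 0) by (apply RtoC_neq; lra).
  unfold omega. rewrite <- Cexp_cis, E. f_equal.
  replace (PI / (2 * INR k + 1) + 2 * PI * INR r / (2 * INR k + 1))
    with (2 * PI * (INR r + / 2) * / (2 * INR k + 1)) by (field; lra).
  rewrite !RtoC_mult, (RtoC_plus (INR r)), (RtoC_inv (2 * INR k + 1)), (RtoC_inv 2) by lra.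
  rewrite RtoC_plus, RtoC_mult in *.
  field. exact HC.
Qed.

(** A real number has no even power equal to -1. *)
Lemma Im_eps_neq_0 (k r : nat) : (1 <= k)%nat -> Im (eps k r) <> 0.
Proof.
  intros Hk E. destruct (eps_root_system k Hk) as [H _]. specialize (H r).
  replace (eps k r) with (RtoC (Re (eps k r))) in H
    by (rewrite (surjective_pairing (eps k r)) at 2;
        unfold RtoC; f_equal; symmetry; exact E).
  rewrite <- RtoC_pow, <- RtoC_opp in H. apply RtoC_inj in H.
  rewrite pow_mult in H.
  assert (H' := pow_le _ k (pow2_ge_0 (Re (eps k r)))). lra.
Qed.

Lemma root_denominator_pos (N n : nat) (x : R) : 0 < x ^ N ->
  0 < INR n ^ N + x ^ N.
Proof.
  intros Hx. assert (H := pow_le _ N (pos_INR n)). lra.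
Qed.

Lemma root_denominator_RtoC (N : nat) (y x : R) :
  (RtoC y ^ N - - (1) * RtoC x ^ N)%C = RtoC (y ^ N + x ^ N).
Proof.
  rewrite RtoC_plus, !RtoC_pow. ring.
Qed.

(** A pole would give [n = zeta x], hence [n ^ N = - x ^ N]. *)
Lemma root_not_pole (N r : nat) (x : R) (zeta : nat -> C) :
  root_system N (- (1))%C zeta -> 0 < x ^ N -> not_pole (- zeta r * x)%C.
Proof.
  intros [Hz _] Hx n E.
  assert (H := root_denominator_pos N n x Hx).
  assert (H' := root_denominator_RtoC N (INR n) x).
  rewrite <- (Hz r), <- Cpow_mult_l in H'.
  replace (RtoC (INR n)) with (zeta r * x)%C in H'.
  - apply (RtoC_neq (INR n ^ N + x ^ N) 0); [lra|]. rewrite <- H'. ring.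
  - replace (RtoC (INR n)) with ((- zeta r * x + INR n) + zeta r * x)%C by ring.
    rewrite E. ring.
Qed.

(** The logarithm in [log_deriv_seq] does not depend on the root and is killed by
    the power sum of exponent [m < N]; the remaining fractions are those of
    [root_system_partial_fraction]. The parameter [x] may be negative: the
    even root system [eps] is used at [x = - w], where it yields
    [psi (eps w)]. *)
Theorem root_average_digamma (N m : nat) (x : R) (zeta : nat -> C) :
  root_system N (- (1))%C zeta -> (1 <= m < N)%nat -> 0 < x ^ N ->
  is_lim_Cseq
    (sum_n (fun n => RtoC (INR N * x ^ (N - m) * INR n ^ (m - 1)
                           / (INR n ^ N + x ^ N))))
    (sum_n (fun r => zeta r ^ m * Cdigamma (- zeta r * x))%C (N - 1)).
Proof.
  intros Hz Hm Hx.
  assert (Hlim : is_lim_Cseq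
    (fun M => sum_n (fun r => zeta r ^ m * log_deriv_seq (- zeta r * x) M)%C (N - 1))
    (sum_n (fun r => zeta r ^ m * Cdigamma (- zeta r * x))%C (N - 1))).
  { apply is_lim_Cseq_sum_n. intros r _. apply is_lim_Cseq_scal, Cdigamma_lim.
    now apply root_not_pole with N. }
  apply is_lim_Cseq_ext with (2 := Hlim). intros M.
  transitivity (ln (INR M) * sum_n (fun r => zeta r ^ m)%C (N - 1)
    + - (1) * sum_n (fun r => sum_n (fun n => zeta r ^ m / (INR n - zeta r * x))%C M)
                    (N - 1))%C.
  - rewrite <- !sum_n_mult_l_C. symmetry.
    etransitivity; [symmetry; apply (sum_n_plus (G := C_AbelianGroup))|].
    apply sum_n_ext_C. intros r _. unfold log_deriv_seq.
    change plus with Cplus. cbv beta.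
    rewrite (sum_n_ext_C (fun n => zeta r ^ m / (INR n - zeta r * x))%C
               (fun n => zeta r ^ m * / (- zeta r * x + INR n))%C).
    + rewrite sum_n_mult_l_C. ring.
    + intros n _. unfold Cdiv. do 2 f_equal. ring.
  - rewrite (proj2 Hz m) by lia. rewrite sum_n_switch, Cmult_0_r, Cplus_0_l.
    rewrite <- sum_n_mult_l_C. apply sum_n_ext_C. intros n _.
    assert (HD := root_denominator_pos N n x Hx).
    assert (HDC := root_denominator_RtoC N (INR n) x).
    assert (HD0 : RtoC (INR n ^ N + x ^ N) <> 0) by (apply RtoC_neq; lra).
    rewrite (root_system_partial_fraction N m _ _ _ _ Hz)
      by first [lia | now rewrite HDC].
    rewrite HDC. rewrite RtoC_div by lra. rewrite !RtoC_mult, !RtoC_pow.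
    unfold Cdiv. ring.
Qed.

(** Pairing the poles [n] and [- n] of [cot] makes the terms functions of
    [eps ^ 2], which runs over the [k] roots of [x ^ k = -1]. The added [k / w] is
    the sum of the [k] terms [eps * 1 / (eps w)] due to the pole at 0 counted
    twice. *)
Theorem root_average_cot (k : nat) (w : R) : (1 <= k)%nat -> 0 < w ->
  is_lim_Cseq
    (sum_n (fun n => RtoC (2 * INR k / w * cutoff w (2 * k) n)))
    (sum_n (fun r => PI * eps k r * Ccot (PI * eps k r * w)) (k - 1) + INR k / w)%C.
Proof.
  intros Hk Hw.
  assert (HwC : RtoC w <> 0) by (apply RtoC_neq; lra).
  assert (Hw2 : 0 < (w ^ 2) ^ k) by (now apply pow_lt, pow_lt).
  assert (HIm : forall r, Im (eps k r * w) <> 0).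
  { intros r. replace (Im (eps k r * w)) with (Im (eps k r) * w)
      by (unfold Im; simpl; ring).
    apply Rmult_integral_contrapositive. split; [now apply Im_eps_neq_0|lra]. }
  assert (Heps : forall r, eps k r <> 0).
  { intros r E. apply (Im_eps_neq_0 k r Hk). now rewrite E. }
  assert (Hlim : is_lim_Cseq
    (fun M => sum_n (fun r => eps k r *
        sum_n (fun n => / (eps k r * w + INR n) + / (eps k r * w - INR n)) M)%C (k - 1))
    (sum_n (fun r => eps k r *
       (PI * Ccot (PI * (eps k r * w)) + / (eps k r * w)))%C (k - 1))).
  { apply is_lim_Cseq_sum_n. intros r _.
    now apply is_lim_Cseq_scal, Ccot_partial_fractions. }
  replace (sum_n (fun r => PI * eps k r * Ccot (PI * eps k r * w)) (k - 1) + INR k / w)%C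
    with (sum_n (fun r => eps k r *
       (PI * Ccot (PI * (eps k r * w)) + / (eps k r * w)))%C (k - 1) : C).
  2:{ replace (INR k / w)%C with (sum_n (fun _ => / w)%C (k - 1) : C).
      - etransitivity; [|apply (sum_n_plus (G := C_AbelianGroup))].
        apply sum_n_ext_C. intros r _. change plus with Cplus. cbv beta.
        replace (PI * eps k r * w)%C with (PI * (eps k r * w))%C by ring.
        field. now split.
      - rewrite sum_n_const_C. now replace (S (k - 1)) with k by lia. }
  apply is_lim_Cseq_ext with (2 := Hlim). intros M.
  rewrite (sum_n_ext_C _ (fun r => sum_n (fun n =>
    - (2 * w) * ((eps k r ^ 2) ^ 1 / (RtoC (INR n ^ 2) - eps k r ^ 2 * RtoC (w ^ 2))))%C M)).
  2:{ intros r _. rewrite <- sum_n_mult_l_C. apply sum_n_ext_C. intros n _.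
      rewrite !RtoC_pow.
      assert (H1 : (eps k r * w + INR n)%C <> 0).
      { intros E. apply (HIm r). apply (f_equal Im) in E.
        unfold Im in *; simpl in *. lra. }
      assert (H2 : (eps k r * w - INR n)%C <> 0).
      { intros E. apply (HIm r). apply (f_equal Im) in E.
        unfold Im in *; simpl in *. lra. }
      replace (INR n ^ 2 - eps k r ^ 2 * w ^ 2)%C
        with (- ((eps k r * w + INR n) * (eps k r * w - INR n)))%C by ring.
      field. now split. }
  rewrite sum_n_switch. apply sum_n_ext_C. intros n _.
  assert (HD : 0 < (INR n ^ 2) ^ k + (w ^ 2) ^ k).
  { assert (H := pow_le _ k (pow2_ge_0 (INR n))). lra. }
  assert (HDC := root_denominator_RtoC k (INR n ^ 2) (w ^ 2)).
  assert (HD0 : RtoC ((INR n ^ 2) ^ k + (w ^ 2) ^ k) <> 0) by (apply RtoC_neq; lra).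
  rewrite sum_n_mult_l_C,
    (root_system_partial_fraction k 1 _ _ _ _ (eps_sqr_root_system k Hk))
    by first [lia | now rewrite HDC].
  rewrite HDC. simpl (1 - 1)%nat.
  unfold cutoff. rewrite !pow_mult.
  replace ((w ^ 2) ^ k) with ((w ^ 2) ^ (k - 1) * w ^ 2) at 2
    by (rewrite <- (Rmult_1_r (w ^ 2)) at 2; change (w ^ 2 * 1) with ((w ^ 2) ^ 1);
        rewrite <- pow_add; f_equal; lia).
  set (D := (INR n ^ 2) ^ k + (w ^ 2) ^ k) in *.
  replace (2 * INR k / w * ((w ^ 2) ^ (k - 1) * w ^ 2 / D))
    with (2 * INR k * w * (w ^ 2) ^ (k - 1) / D) by (field; lra).
  rewrite RtoC_div by lra. rewrite !RtoC_mult, (RtoC_pow (w ^ 2)).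
  simpl (Cpow _ 0). unfold Cdiv. ring.
Qed.

(** * The three limits *)
Lemma power_sum_lim_0 (w : R) : 0 < w ->
  power_sum_lim w 0
  = IZR (Int_part w) + 1 - (if is_integer_dec w then / 2 else 0).
Proof.
  intros Hw. unfold power_sum_lim. rewrite <- (INR_Int_part w) by lra.
  set (K := Z.to_nat (Int_part w)).
  replace (sum_n (fun n => INR n ^ 0) K) with (INR (S K)).
  - rewrite S_INR. destruct (is_integer_dec w); simpl; lra.
  - symmetry. etransitivity; [apply (sum_n_const K 1)|]. apply Rmult_1_r.
Qed.

Lemma power_sum_lim_bernoulli (w : R) (l : nat) : 0 < w -> (1 <= l)%nat ->
  power_sum_lim w l
  = (bernoulli_poly (l + 1) (IZR (Int_part w)) - bernoulli (l + 1)) / INR (l + 1)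
    + kappa w * IZR (Int_part w) ^ l.
Proof.
  intros Hw Hl. unfold power_sum_lim, kappa. rewrite <- (INR_Int_part w) by lra.
  rewrite bernoulli_power_sum, Nat.add_1_r by trivial.
  destruct (is_integer_dec w); field; apply not_0_INR; lia.
Qed.

Lemma Int_part_integer (w : R) : is_integer w -> IZR (Int_part w) = w.
Proof.
  intros [z ->]. f_equal. symmetry. apply Int_part_spec. lra.
Qed.

Theorem is_lim_a_ (w : R) : 0 < w ->
  is_lim_Cseq (fun k => a_ k w) (a_lim w).
Proof.
  intros Hw. assert (HwC : RtoC w <> 0) by (apply RtoC_neq; lra).
  assert (HS : is_lim_Cseq (fun k => w / 2 * (a_ k w + / w))%C
                 (RtoC (power_sum_lim w 0))).
  { apply (cutoff_power_sum w 0 _ (fun k => (2 * k)%nat) Hw).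
    - apply eventually_subseq. intros; lia.
    - exists 1%nat. intros k Hk.
      assert (Hk0 : 0 < INR k) by (apply lt_0_INR; lia).
      assert (HkC : RtoC (INR k) <> 0) by (apply RtoC_neq; lra).
      assert (H := is_lim_Cseq_scal (w / (2 * INR k)) _ _ (root_average_cot k w Hk Hw)).
      replace (w / 2 * (a_ k w + / w))%C with
        (w / (2 * INR k) * (sum_n (fun r => PI * eps k r * Ccot (PI * eps k r * w))
                              (k - 1) + INR k / w))%C
        by (unfold a_; field; now split).
      apply is_lim_Cseq_ext with (2 := H). intros M.
      rewrite <- sum_n_mult_l_C. apply sum_n_ext_C. intros n _.
      rewrite !RtoC_mult, RtoC_div, RtoC_mult by lra. simpl (INR n ^ 0).
      field. now split. }
  apply (is_lim_Cseq_scal (2 / w)) in HS.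
  apply (fun H => is_lim_Cseq_minus _ _ _ _ H (is_lim_Cseq_const (/ w))) in HS.
  replace (RtoC (a_lim w)) with (2 / w * power_sum_lim w 0 - / w)%C.
  - apply is_lim_Cseq_ext with (2 := HS). intros k. field. exact HwC.
  - rewrite <- RtoC_div, <- RtoC_inv, <- RtoC_mult, <- RtoC_minus by lra.
    f_equal. rewrite power_sum_lim_0 by trivial. unfold a_lim.
    destruct (is_integer_dec w) as [Hi|Hi].
    + rewrite (Int_part_integer w Hi). field. lra.
    + field. lra.
Qed.

Theorem is_lim_b_ (w : R) (l : nat) : 0 < w -> (1 <= l)%nat ->
  is_lim_Cseq (fun k => b_ k l w) (b_lim l w).
Proof.
  intros Hw Hl. assert (Hwl : 0 < w ^ (l + 1)) by now apply pow_lt.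
  assert (HwC : RtoC (w ^ (l + 1)) <> 0) by (apply RtoC_neq; lra).
  assert (HS : is_lim_Cseq (fun k => RtoC (w ^ (l + 1)) / 2 * b_ k l w)%C
                 (RtoC (power_sum_lim w l))).
  { apply (cutoff_power_sum w l _ (fun k => (2 * k)%nat) Hw).
    - apply eventually_subseq. intros; lia.
    - exists (l + 2)%nat. intros k Hk.
      assert (Hk0 : 0 < INR k) by (apply lt_0_INR; lia).
      assert (HkC : RtoC (INR k) <> 0) by (apply RtoC_neq; lra).
      assert (Hpow : forall p, (- w) ^ p = (- (1)) ^ p * w ^ p)
        by (intros p; rewrite <- Rpow_mult_distr; f_equal; ring).
      assert (Heven : (- w) ^ (2 * k) = w ^ (2 * k))
        by (rewrite !pow_mult; f_equal; ring).
      assert (H := root_average_digamma (2 * k) (l + 1) (- w) (eps k)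
        (eps_root_system k ltac:(lia)) ltac:(lia)
        ltac:(rewrite Heven; now apply pow_lt)).
      apply (is_lim_Cseq_scal (RtoC (w ^ (l + 1)) / 2 * ((- (1)) ^ (l + 1) / INR k))%C) in H.
      replace (RtoC (w ^ (l + 1)) / 2 * b_ k l w)%C with
        (RtoC (w ^ (l + 1)) / 2 * ((- (1)) ^ (l + 1) / INR k)
         * sum_n (fun r => eps k r ^ (l + 1) * Cdigamma (- eps k r * (- w)%R)) (2 * k - 1))%C.
      2:{ unfold b_. rewrite <- Cmult_assoc. f_equal. f_equal.
          - f_equal. f_equal. apply injective_projections; simpl; ring.
          - apply sum_n_ext_C. intros r _. do 2 f_equal. rewrite RtoC_opp. ring. }
      apply is_lim_Cseq_ext with (2 := H). intros M.
      rewrite <- sum_n_mult_l_C. apply sum_n_ext_C. intros n _.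
      rewrite Heven. replace (l + 1 - 1)%nat with l by lia.
      assert (HD := root_denominator_pos (2 * k) n w ltac:(now apply pow_lt)).
      rewrite <- RtoC_opp, <- RtoC_pow, <- !RtoC_div, <- !RtoC_mult by lra.
      f_equal. unfold cutoff. rewrite Hpow.
      assert (Hw2k : w ^ (2 * k) = w ^ (l + 1) * w ^ (2 * k - (l + 1)))
        by (rewrite <- pow_add; f_equal; lia).
      (* The sign in front of [b_] cancels the one produced by evaluating at
         [- w]. *)
      assert (Hsign : (- (1)) ^ (l + 1) * (- (1)) ^ (2 * k - (l + 1)) = 1).
      { rewrite <- pow_add. replace (l + 1 + (2 * k - (l + 1)))%nat with (2 * k)%nat by lia.
        rewrite pow_mult. replace ((- (1)) ^ 2) with 1 by ring. apply pow1. }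
      set (D := INR n ^ (2 * k) + w ^ (2 * k)) in *. rewrite Hw2k, mult_INR.
      transitivity (((- (1)) ^ (l + 1) * (- (1)) ^ (2 * k - (l + 1)))
        * (INR n ^ l * (w ^ (l + 1) * w ^ (2 * k - (l + 1)) / D)));
        [simpl (INR 2); field; lra | rewrite Hsign; ring]. }
  apply (is_lim_Cseq_scal (2 / RtoC (w ^ (l + 1)))) in HS.
  replace (RtoC (b_lim l w)) with (2 / RtoC (w ^ (l + 1)) * power_sum_lim w l)%C.
  - apply is_lim_Cseq_ext with (2 := HS). intros k. field. exact HwC.
  - rewrite <- RtoC_div, <- RtoC_mult by lra.
    unfold b_lim. now rewrite power_sum_lim_bernoulli.
Qed.

Theorem is_lim_c_ (w : R) : 0 < w ->
  is_lim_Cseq (fun k => c_ k w) (c_lim w).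
Proof.
  intros Hw. assert (HwC : RtoC w <> 0) by (apply RtoC_neq; lra).
  assert (HS : is_lim_Cseq (fun k => w * c_ k w)%C (RtoC (power_sum_lim w 0))).
  { apply (cutoff_power_sum w 0 _ (fun k => (2 * k + 1)%nat) Hw).
    - apply eventually_subseq. intros; lia.
    - exists 1%nat. intros k Hk.
      assert (E : INR (2 * k + 1) = 2 * INR k + 1)
        by (rewrite plus_INR, mult_INR; simpl; ring).
      assert (H0 := pos_INR k).
      assert (H := root_average_digamma (2 * k + 1) 1 w (omega k)
        (omega_root_system k) ltac:(lia) ltac:(now apply pow_lt)).
      apply (is_lim_Cseq_scal (RtoC (w / (2 * INR k + 1)))) in H.
      replace (w * c_ k w)%C with
        (RtoC (w / (2 * INR k + 1)) * sum_n (fun r => omega k r ^ 1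
           * Cdigamma (- omega k r * w)) (2 * k + 1 - 1))%C.
      2:{ unfold c_. rewrite RtoC_div, RtoC_plus, RtoC_mult by lra.
          unfold Cdiv. rewrite <- Cmult_assoc. do 2 f_equal.
          replace (2 * k + 1 - 1)%nat with (2 * k)%nat by lia.
          apply sum_n_ext_C. intros r _. now rewrite Cpow_1_r. }
      apply is_lim_Cseq_ext with (2 := H). intros M.
      rewrite <- sum_n_mult_l_C. apply sum_n_ext_C. intros n _.
      rewrite <- RtoC_mult. f_equal. unfold cutoff.
      assert (HD := root_denominator_pos (2 * k + 1) n w ltac:(now apply pow_lt)).
      set (D := INR n ^ (2 * k + 1) + w ^ (2 * k + 1)) in *.
      replace (2 * k + 1 - 1)%nat with (2 * k)%nat by lia.
      rewrite E, (pow_add w), pow_1. simpl (INR n ^ (1 - 1)).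
      simpl (INR n ^ 0). field. lra. }
  apply (is_lim_Cseq_scal (/ w)) in HS.
  replace (RtoC (c_lim w)) with (/ w * power_sum_lim w 0)%C.
  - apply is_lim_Cseq_ext with (2 := HS). intros k. field. exact HwC.
  - rewrite <- RtoC_inv, <- RtoC_mult by lra. f_equal.
    rewrite power_sum_lim_0 by trivial. unfold c_lim.
    destruct (is_integer_dec w) as [Hi|Hi].
    + rewrite (Int_part_integer w Hi). field. lra.
    + field. lra.
Qed.

Theorem theorem7 (w : R) (l : nat) (hw : (0 < w)%R) (hl : (1 <= l)%nat) :
  filterlim (fun k : nat => a_ k w) eventually (locally (RtoC (a_lim w))) /\
  filterlim (fun k : nat => b_ k l w) eventually (locally (RtoC (b_lim l w))) /\
  filterlim (fun k : nat => c_ k w) eventually (locally (RtoC (c_lim w))).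
Proof.
  repeat split; apply is_lim_Cseq_filterlim.
  - now apply is_lim_a_.
  - now apply is_lim_b_.
  - now apply is_lim_c_.
Qed.
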